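(* Assume that $\mathscr H$ is a nonnegative bounded operator on $\ell^s$ of its index set, for some $1\le s\le\infty$, and let $0\le\tau<\rho(\mathscr H)^{-1}$, where the spectral radius is taken on this space. Fix $m\in\mathbb N_0$. Then the sequence of matrices $(\mathsf X_k)_{k\ge m}$, $\mathsf X_k=\mathsf X_k(\tau)\in\mathbb C^{|\mathscr V_k|\times|\mathscr V_m|}$, is the least entrywise nonnegative solution of \[ (I-\tau\mathsf A_m)\mathsf X_m-\tau\mathsf B_m\mathsf X_{m+1}=I, \] \[ -\tau\mathsf C_{k-1}\mathsf X_{k-1}+(I-\tau\mathsf A_k)\mathsf X_k-\tau\mathsf B_k\mathsf X_{k+1}=0,\qquad k>m . \] Moreover, \[ \mathsf X_m=\Phi_m,\qquad \mathsf X_{m+1}=\tau\,\Phi_{m+1}\mathsf C_m\Phi_m . \] For each fixed $k\ge m$, the corresponding finite blocks $\mathsf X_k^{[m,N]}$, with the terminal condition $\mathsf X_{N+1}^{[m,N]}=0$, increase entrywise to $\mathsf X_k$ as $N\to\infty$.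
   Context: Let $p,q\ge1$, $M=p+q$, $d=\gcd(p,q)$, $P=p/d$, $Q=q/d$, $R=P+Q$. Let $L_1,\dots,L_p$ be semi-infinite (indexed by $\mathbb N_0$) lower bidiagonal matrices with $(L_a)_{n,n}=1$, $(L_a)_{n+1,n}=\ell_n^{(a)}$, and $U_1,\dots,U_q$ upper bidiagonal with $(U_b)_{n,n}=u_n^{(b)}$, $(U_b)_{n,n+1}=1$. Height-ordered matrix $\mathscr H$ of the order $L_1,\dots,L_p,U_q,\dots,U_1$: put $\omega_j=(j-1)Q$ for $1\le j\le p$ and $\omega_{p+b}=(q-b+1)P$ for $1\le b\le q$. Rows and columns are indexed by pairs $(h,j)$ with $h\in\mathbb N_0$, $j\in\{1,\dots,M\}$, $h-\omega_j\in R\mathbb N_0$, ordered by $h$ and then $j$; $n_j(h)=(h-\omega_j)/R$; $j^+=j+1$ for $j<M$, $M^+=1$. The only nonzero entries are $\mathscr H_{(h,j),(h+Q,j^+)}=1$; $\mathscr H_{(h,j),(h-P,j^+)}=\ell^{(j)}_{n_j(h)-1}$ for $1\le j\le p$, $n_j(h)\ge1$; $\mathscr H_{(h,p+b),(h-P,(p+b)^+)}=u^{(q-b+1)}_{n_{p+b}(h)}$ for $1\le b\le q$. Height blocks: $w=\max(P,Q)$; $\mathscr V_m$ is the finite set of indices with $mw\le h<(m+1)w$. $\mathscr H$ is block tridiagonal for $\mathscr V_0,\mathscr V_1,\dots$ with blocks $\mathsf A_m$ ($\mathscr V_m\times\mathscr V_m$), $\mathsf B_m$ ($\mathscr V_m\times\mathscr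 V_{m+1}$), $\mathsf C_m$ ($\mathscr V_{m+1}\times\mathscr V_m$). $\mathscr H^{\langle m\rangle}$ and $\mathscr H^{[m,N]}$ are the principal submatrices on $\bigcup_{k\ge m}\mathscr V_k$ and $\bigcup_{k=m}^N\mathscr V_k$. Put $\Phi_m(\tau)=[(I-\tau\mathscr H^{\langle m\rangle})^{-1}]_{\mathscr V_m\times\mathscr V_m}$, $\mathsf X_k(\tau)=[(I-\tau\mathscr H^{\langle m\rangle})^{-1}]_{\mathscr V_k\times\mathscr V_m}$ for $k\ge m$, and $\mathsf X_k^{[m,N]}(\tau)=[(I-\tau\mathscr H^{[m,N]})^{-1}]_{\mathscr V_k\times\mathscr V_m}$ for $m\le k\le N$. ''Least'' means entrywise dominated by every other entrywise nonnegative solution. *)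

(* Defs.v *)
From HB Require Import structures.
From mathcomp Require Import all_boot all_order all_algebra.
From mathcomp Require Import complex.
From mathcomp Require Import all_classical all_reals all_analysis.

Set Implicit Arguments.
Unset Strict Implicit.
Unset Printing Implicit Defensive.

Import Order.TTheory GRing.Theory Num.Theory.
Import numFieldNormedType.Exports.

Local Open Scope classical_set_scope.
Local Open Scope ring_scope.

Section SequenceSpaces.
Context {R : realType} {T : choiceType}.
Implicit Types (s : \bar R) (f g : T -> R[i]).
Implicit Types F G : (T -> R[i]) -> (T -> R[i]).

Definition lnorm s f : \bar R :=
  match s with
  | r%:E => ((\esum_(x in [set: T]) ((Normc.normc (f x)) `^ r)%:E)
              `^ r^-1)%E
  | +oo%E => ereal_sup (range (fun x => (Normc.normc (f x))%:E))
  | -oo%E => 0%E (* junk value: only 1 <= s is used *)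
  end.

Definition ell s : set (T -> R[i]) := [set f | (lnorm s f < +oo)%E].

(* Operators are total on functions T -> R[i], but only their restriction to
   ell s is ever constrained. The norm bound implies that F maps ell s into
   itself. *)
Definition bounded_operator s F : Prop :=
  (forall (a : R[i]) f g, ell s f -> ell s g ->
     F (fun x => a * f x + g x) = (fun x => a * F f x + F g x)) /\
  (exists K : R, forall f, ell s f -> (lnorm s (F f) <= K%:E * lnorm s f)%E).

Definition is_inverse s F G : Prop :=
  bounded_operator s G /\
  (forall f, ell s f -> G (F f) = f /\ F (G f) = f).

Definition invertible s F : Prop := exists G, is_inverse s F G.

(* The inverse of F in the algebra of bounded operators on ell s, unique on
   ell s; the identity if F is not invertible. *)
Definition opinv s F : (T -> R[i]) -> (T -> R[i]) :=
  xget (fun f => f) [set G | is_inverse s F G].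

Definition spectrum s F : set R[i] :=
  [set z | ~ invertible s (fun f x => z * f x - F f x)].

Definition spectral_radius s F : \bar R :=
  ereal_sup [set (Normc.normc z)%:E | z in spectrum s F].

(* The action of an infinite matrix with finitely supported rows: the finitely
   supported sum \sum_(y \in _) is zero on an infinite support. *)
Definition matop (A : T -> T -> R[i]) : (T -> R[i]) -> (T -> R[i]) :=
  fun f x => \sum_(y \in [set: T]) A x y * f y.

Definition unit_vec (y : T) : T -> R[i] := fun x => (x == y)%:R.

End SequenceSpaces.

Section Indices.
Variables p q : nat.

Definition Pred : nat := p %/ gcdn p q.
Definition Qred : nat := q %/ gcdn p q.
Definition Rred : nat := Pred + Qred.
Definition width : nat := maxn Pred Qred.

(* The second index j in {1, ..., M} is represented by j - 1 : 'I_(p + q).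
   Under split, inl a is the position of L_(a+1) and inr b is position
   p + (b + 1), whose factor is U_(q-b). *)
Definition omega (j : 'I_(p + q)) : nat :=
  match fintype.split j with
  | inl a => a * Qred
  | inr b => (q - b) * Pred
  end.

Definition hvalid (x : nat * 'I_(p + q)) : bool :=
  (omega x.2 <= x.1)%N && (Rred %| x.1 - omega x.2)%N.

Definition hidx := {x : nat * 'I_(p + q) | hvalid x}.

Definition height (x : hidx) : nat := (val x).1.
Definition pos (x : hidx) : 'I_(p + q) := (val x).2.
Definition level (x : hidx) : nat := (height x - omega (pos x)) %/ Rred.

(* The indices with a <= h < b, ordered by h and then j. *)
Definition hrange (a b : nat) : seq hidx :=
  pmap insub [seq (h, j) | h <- iota a (b - a), j <- enum 'I_(p + q)].

Definition V (k : nat) : seq hidx := hrange (k * width) (k.+1 * width).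
Definition Vseg (m N : nat) : seq hidx := hrange (m * width) (N.+1 * width).

Definition hidx_ge (m : nat) := {x : hidx | (m * width <= height x)%N}.

Definition submat (K : Type) (G : hidx -> hidx -> K) (r c : seq hidx) :
    'M[K]_(size r, size c) :=
  \matrix_(i, j) G (tnth (in_tuple r) i) (tnth (in_tuple c) j).

End Indices.

Definition mxle (K : numDomainType) (r c : nat) (A B : 'M[K]_(r, c)) : Prop :=
  forall i j, A i j <= B i j.

Section HeightOrdered.
Context {R : realType} {p q : nat}.
Variables (l : 'I_p -> nat -> R[i]) (u : 'I_q -> nat -> R[i]).
Local Notation hidx := (hidx p q).
Local Notation V := (V p q).

Definition hmat (x y : hidx) : R[i] :=
  if pos y != ordS (pos x) then 0
  else if height y == (height x + Qred p q)%N then 1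
  else if (height y + Pred p q)%N == height x then
    match fintype.split (pos x) with
    | inl a => if level x is n.+1 then l a n else 0
    | inr b => u (rev_ord b) (level x)
    end
  else 0.

Definition Ablk (k : nat) : 'M[R[i]]_(size (V k)) :=
  submat hmat (V k) (V k).
Definition Bblk (k : nat) : 'M[R[i]]_(size (V k), size (V k.+1)) :=
  submat hmat (V k) (V k.+1).
Definition Cblk (k : nat) : 'M[R[i]]_(size (V k.+1), size (V k)) :=
  submat hmat (V k.+1) (V k).

Definition hmat_ge (m : nat) (x y : hidx_ge p q m) : R[i] :=
  hmat (val x) (val y).

Definition id_sub_tau (m : nat) (tau : R) :
    (hidx_ge p q m -> R[i]) -> (hidx_ge p q m -> R[i]) :=
  fun f x => f x - tau%:C%C * matop (@hmat_ge m) f x.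

(* The matrix of the inverse of I - tau H^<m> on ell s, that is, the
   x-coordinate of the image of the unit vector at y; extended by zero to all
   pairs of indices. *)
Definition inv_ge (s : \bar R) (m : nat) (tau : R) (x y : hidx) : R[i] :=
  match (insub x : option (hidx_ge p q m)),
        (insub y : option (hidx_ge p q m)) with
  | Some x', Some y' => opinv s (id_sub_tau (m := m) tau) (unit_vec y') x'
  | _, _ => 0
  end.

Definition Phi (s : \bar R) (m : nat) (tau : R) : 'M[R[i]]_(size (V m)) :=
  submat (inv_ge s m tau) (V m) (V m).

Definition Xblk (s : \bar R) (m : nat) (tau : R) (k : nat) :
    'M[R[i]]_(size (V k), size (V m)) :=
  submat (inv_ge s m tau) (V k) (V m).

Definition id_sub_tau_seg (m N : nat) (tau : R) :
    'M[R[i]]_(size (Vseg p q m N)) :=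
  1%:M - tau%:C%C *: submat hmat (Vseg p q m N) (Vseg p q m N).

(* The matrix (I - tau H^[m,N])^-1, extended by zero to all pairs of indices;
   in particular its block at k = N + 1 is zero. *)
Definition inv_seg (m N : nat) (tau : R) (x y : hidx) : R[i] :=
  match (insub (index x (Vseg p q m N)) : option 'I_(size (Vseg p q m N))),
        (insub (index y (Vseg p q m N)) : option 'I_(size (Vseg p q m N))) with
  | Some i, Some j => invmx (id_sub_tau_seg m N tau) i j
  | _, _ => 0
  end.

Definition Xseg (m N : nat) (tau : R) (k : nat) :
    'M[R[i]]_(size (V k), size (V m)) :=
  submat (inv_seg m N tau) (V k) (V m).

(* The block equations for a family Y_k, of which only the terms with k >= m
   are used; later_equation k is the equation of index k + 1. *)
Definition first_equation (tau : R) (m : nat)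
    (Y : forall k, 'M[R[i]]_(size (V k), size (V m))) : Prop :=
  (1%:M - tau%:C%C *: Ablk m) *m Y m - tau%:C%C *: (Bblk m *m Y m.+1) = 1%:M.

Definition later_equation (tau : R) (m : nat)
    (Y : forall k, 'M[R[i]]_(size (V k), size (V m))) (k : nat) : Prop :=
  - (tau%:C%C *: (Cblk k *m Y k)) + (1%:M - tau%:C%C *: Ablk k.+1) *m Y k.+1
    - tau%:C%C *: (Bblk k.+1 *m Y k.+2) = 0.

Definition nonneg_solution (tau : R) (m : nat)
    (Y : forall k, 'M[R[i]]_(size (V k), size (V m))) : Prop :=
  [/\ forall k, (m <= k)%N -> mxle 0 (Y k),
      first_equation tau Y
    & forall k, (m <= k)%N -> later_equation tau Y k].

Definition least_nonneg_solution (tau : R) (m : nat)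
    (X : forall k, 'M[R[i]]_(size (V k), size (V m))) : Prop :=
  nonneg_solution tau X /\
  forall Y, nonneg_solution tau Y ->
    forall k, (m <= k)%N -> mxle (X k) (Y k).

End HeightOrdered.

(* Main.v *)
Require Import Defs.
From mathcomp Require Import all_boot all_order all_algebra.
From mathcomp Require Import complex.
From mathcomp Require Import all_classical all_reals all_analysis.
From mathcomp Require Import zify ring lra.
Import Order.TTheory GRing.Theory Num.Theory.
Import numFieldNormedType.Exports.
Local Open Scope classical_set_scope.
Local Open Scope ring_scope.

(** Write [H] for the height-ordered matrix. The hypothesis concerns the spectrum of
    [H] alone, while the theorem speaks of its compressions and of entrywise
    inequalities. The bridge is positivity: for [0 <= tau < 1/rho(H)] the inverse of
    [I - tau H] preserves nonnegative functions.

    For every [t] in [[0, tau]] the operator [I - t H] has a bounded inverse, because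
    [1/t] is outside the spectrum. Positivity holds at [t = 0] and propagates along
    the segment: if [(I - t' H) v >= 0], with [t'] slightly larger than a good
    parameter [t], then the negative part of [v] is dominated by a function whose
    norm is at most a fraction of itself ([inverse_positive_step],
    [inverse_positive_upto]).

    Positivity passes to the compression of [H] to any set [D] of indices: if
    [d >= tau H d] on [D] and [d >= 0] outside [D], then [d >= 0]
    ([compression_positive]). This yields uniqueness of solutions of the compressed
    equation, a norm bound by comparison with the solution on the whole index set,
    existence by Neumann iteration below that solution, and monotonicity in [D]
    ([solves_unique], [solves_bound], [solves_exists], [solves_mono]). In particular
    the compression to the heights from block [m] on has a bounded nonnegative
    inverse, and so have the finite segments, where the inverse is the matrix
    inverse ([inv_seg_spec]).

    Since [H] changes the height by at most one block, the block equations for a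
    family of blocks are the coordinates of a single equation [(I - tau H) g = e_c]
    for each column ([first_equationP], [later_equationP]), which the columns of the
    inverse satisfy. The finite inverses increase with [N], and their limit solves
    the infinite equation, hence is the infinite inverse ([solves_cvg]). An arbitrary
    nonnegative solution, truncated to finitely many blocks, is a supersolution of
    the finite equation, so it dominates every finite inverse and therefore the limit
    ([Xblk_least]). The formula for block [m.+1] is uniqueness for the compression
    starting at [m.+1], with the source that block [m] feeds into it
    ([inv_ge_next_block]). *)

Set Implicit Arguments.
Unset Strict Implicit.

(** * The norms of the sequence spaces *)

Section Norms.
Context {R : realType} {T : choiceType}.
Variable s : \bar R.
Hypothesis hs : (1 <= s)%E.
Implicit Types f g : T -> R[i].

Lemma exponentP : s = +oo%E \/ exists2 r : R, 0 < r & s = r%:E.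
Proof.
move: hs; case: s => [r| |] h1; [right | by left | by []].
by exists r => //; move: h1; rewrite lee_fin; exact: lt_le_trans.
Qed.

Lemma normcE_norm (z : R[i]) : (Normc.normc z)%:C%C = `|z|.
Proof. by rewrite normc_def; case: z. Qed.

Lemma normc_ge0 (z : R[i]) : 0 <= Normc.normc z.
Proof. by rewrite -ler0c normcE_norm. Qed.

Lemma normc_le (z w : R[i]) : `|z| <= `|w| -> Normc.normc z <= Normc.normc w.
Proof. by rewrite -!normcE_norm lecR. Qed.

Lemma normcZ (c : R) (z : R[i]) : 0 <= c ->
  Normc.normc (c%:C%C * z) = c * Normc.normc z.
Proof.
by move=> c0; apply: complexI; rewrite rmorphM /= !normcE_norm normrM ger0_norm ?ler0c.
Qed.

Lemma poweR_homo (r : R) (x y : \bar R) : 0 <= r -> (0 <= x)%E -> (x <= y)%E ->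
  (x `^ r <= y `^ r)%E.
Proof.
move=> r0 x0 xy; apply: gt0_ler_poweR => //; rewrite in_itv /= ?leey ?andbT //.
exact: le_trans xy.
Qed.

Lemma powR_homo (r x y : R) : 0 <= r -> 0 <= x -> x <= y -> x `^ r <= y `^ r.
Proof. by move=> r0 x0 xy; rewrite ge0_ler_powR// nnegrE// (le_trans x0). Qed.

Lemma lnorm_le f g : (forall x, `|f x| <= `|g x|) -> (lnorm s f <= lnorm s g)%E.
Proof.
move=> fg; have [->|[r r0 ->]] := exponentP.
  apply: ge_ereal_sup => _ [x _ <-]; apply: (@le_trans _ _ (Normc.normc (g x))%:E).
    by rewrite lee_fin normc_le.
  by apply: ereal_sup_ubound; exists x.
apply: poweR_homo; first by rewrite invr_ge0 ltW.
  by apply: esum_ge0 => x _; rewrite lee_fin powR_ge0.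
apply: le_esum => x _; rewrite lee_fin powR_homo ?normc_ge0 ?normc_le//.
exact: ltW.
Qed.

Lemma ell_le f g : (forall x, `|f x| <= `|g x|) -> ell s g -> ell s f.
Proof. by move=> /lnorm_le; exact: le_lt_trans. Qed.

Lemma lnorm_abs f : lnorm s (fun x => `|f x|) = lnorm s f.
Proof. by apply: le_anti; rewrite !lnorm_le // => x; rewrite normr_id. Qed.

Lemma lnormZ (c : R) f : 0 <= c ->
  (lnorm s (fun x => (c%:C%C * f x)%R) <= c%:E * lnorm s f)%E.
Proof.
move=> c0; have [->|[r r0 ->]] := exponentP.
  apply: ge_ereal_sup => _ [x _ <-]; rewrite normcZ// EFinM.
  by apply: lee_wpmul2l; rewrite ?lee_fin//; apply: ereal_sup_ubound; exists x.
have r0' := ltW r0.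
have le1 : (\esum_(x in [set: T]) ((Normc.normc (c%:C%C * f x)%R) `^ r)%:E
   <= (c `^ r)%:E * \esum_(x in [set: T]) ((Normc.normc (f x)) `^ r)%:E)%E.
  apply: ge_ereal_sup => _ [X XT <-].
  rewrite (eq_fsbigr (fun x => (c `^ r)%:E * ((Normc.normc (f x)) `^ r)%:E)%E); last first.
    by move=> x _; rewrite -EFinM -powRM ?normc_ge0// normcZ.
  rewrite -ge0_mule_fsumr; last by move=> x; rewrite lee_fin powR_ge0.
  by apply: lee_wpmul2l; rewrite ?lee_fin ?powR_ge0//; apply: esum_ge; exists X.
have le2 := @poweR_homo r^-1 _ _ _ _ le1.
apply: le_trans (le2 _ _) _; first by rewrite invr_ge0.
  by apply: esum_ge0 => x _; rewrite lee_fin powR_ge0.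
rewrite poweRM ?lee_fin ?powR_ge0//; last first.
  by apply: esum_ge0 => x _; rewrite lee_fin powR_ge0.
by rewrite poweR_EFin -powRrM mulfV ?gt_eqF// powRr1.
Qed.

Lemma lnorm_ge f x : ((Normc.normc (f x))%:E <= lnorm s f)%E.
Proof.
have [->|[r r0 ->]] := exponentP; first by apply: ereal_sup_ubound; exists x.
have -> : (Normc.normc (f x))%:E = ((((Normc.normc (f x)) `^ r)%:E) `^ r^-1)%E.
  by rewrite poweR_EFin -powRrM mulfV ?gt_eqF// powRr1 ?normc_ge0.
apply: poweR_homo; rewrite ?invr_ge0 ?lee_fin ?powR_ge0 ?(ltW r0)//.
apply: esum_ge; exists [set x]; last by rewrite fsbig_set1.
by split=> //; exact: finite_set1.
Qed.

(** The point [x] is needed: on an empty index set the supremum norm is [-oo]. *)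
Lemma lnorm_ge0 (x : T) f : (0 <= lnorm s f)%E.
Proof. by apply: le_trans (lnorm_ge f x); rewrite lee_fin normc_ge0. Qed.

(** Finiteness follows from [|f + g| <= 2 max(|f|, |g|)] together with
    [max(a, b)^r <= a^r + b^r]. *)
Lemma ell_add f g : ell s f -> ell s g -> ell s (fun x => f x + g x).
Proof.
pose h (x : T) : R[i] := (Num.max (Normc.normc (f x)) (Normc.normc (g x)))%:C%C.
have hE x : `|h x| = h x.
  by rewrite ger0_norm // /h ler0c le_max normc_ge0.
have hN x : Normc.normc (h x) = Num.max (Normc.normc (f x)) (Normc.normc (g x)).
  by apply: complexI; rewrite normcE_norm hE.
move=> ef eg; have eh : ell s h.
  move: ef eg; rewrite /ell /=; have [->|[r r0 ->]] := exponentP.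
    move=> ef eg; apply: (@le_lt_trans _ _
      (maxe (lnorm +oo%E f) (lnorm +oo%E g))); last by rewrite gt_max ef eg.
    apply: ge_ereal_sup => _ [x _ <-]; rewrite hN EFin_max.
    rewrite ge_max !le_max; apply/andP; split; apply/orP; [left | right];
      by apply: ereal_sup_ubound; exists x.
  move=> /lty_poweRy; rewrite invr_neq0 ?gt_eqF// => /(_ isT) ef.
  move=> /lty_poweRy; rewrite invr_neq0 ?gt_eqF// => /(_ isT) eg.
  apply: poweR_lty; apply: (@le_lt_trans _ _ (\esum_(x in [set: T])
     (((Normc.normc (f x)) `^ r)%:E + ((Normc.normc (g x)) `^ r)%:E))%E).
    apply: le_esum => x _; rewrite hN -EFinD lee_fin /Num.max.
    by case: ifP => _; rewrite ?lerDl ?lerDr powR_ge0.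
  by rewrite esumD ?lte_add_pinfty // => x _; rewrite lee_fin powR_ge0.
apply: (@ell_le _ (fun x => 2%:C%C * h x)).
  move=> x; rewrite normrM hE ger0_norm ?ler0c// (le_trans (ler_normD _ _))//.
  rewrite -!normcE_norm -!rmorphM -rmorphD lecR mulr_natl mulr2n.
  by apply: lerD; rewrite le_max lexx ?orbT.
by apply: le_lt_trans (lnormZ h _) _; rewrite // lte_mul_pinfty// lee_fin.
Qed.

Lemma ellZ (c : R[i]) f : ell s f -> ell s (fun x => c * f x).
Proof.
move=> ef; apply: (@ell_le _ (fun x => (Normc.normc c)%:C%C * f x)).
  by move=> x; rewrite !normrM normcE_norm normr_id.
apply: le_lt_trans (lnormZ _ (normc_ge0 c)) _.
have:= normc_ge0 c; move: (Normc.normc c) => d; rewrite le_eqVlt => /predU1P[<-|d0].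
  by rewrite mul0e ltry.
move: ef; rewrite /ell /=; case: (lnorm s f) => [a| |] // _; first by rewrite ltry.
by rewrite gt0_muleNy ?lte_fin.
Qed.

Lemma ell_sub f g : ell s f -> ell s g -> ell s (fun x => f x - g x).
Proof.
move=> ef /(ellZ (-1)) eg; have := ell_add ef eg.
by congr (ell s _); apply/funext => x; rewrite mulN1r.
Qed.

Lemma ell_abs f : ell s f -> ell s (fun x => `|f x|).
Proof. by apply: ell_le => x; rewrite normr_id. Qed.

Lemma ell_finite_support (r : seq T) f :
  (forall x, x \notin r -> f x = 0) -> ell s f.
Proof.
move=> f0; rewrite /ell /=; have [->|[e e0 ->]] := exponentP.
  apply: (@le_lt_trans _ _ (\sum_(y <- undup r) Normc.normc (f y))%:E); last exact: ltry.
  apply: ge_ereal_sup => _ [x _ <-]; rewrite lee_fin.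
  case: (boolP (x \in r)) => [xr|/f0 ->]; last first.
    by rewrite Normc.normc0 sumr_ge0// => y _; exact: normc_ge0.
  rewrite (bigD1_seq x) ?mem_undup ?undup_uniq//= lerDl sumr_ge0// => y _.
  exact: normc_ge0.
apply: poweR_lty.
have -> : \esum_(x in [set: T]) ((Normc.normc (f x)) `^ e)%:E =
          \esum_(x in [set` r]) ((Normc.normc (f x)) `^ e)%:E.
  rewrite [RHS]esum_mkcond; apply: eq_esum => x _.
  case: ifPn => // /negP; rewrite inE /= => /negP /f0 ->.
  by rewrite Normc.normc0 powR0 ?gt_eqF.
rewrite esum_fset //; last by move=> x _; rewrite lee_fin powR_ge0.
by rewrite fsbig_finite //= sumEFin ltry.
Qed.

End Norms.

(** * Subtypes and extension by zero *)

Definition ext0 {R : realType} {T : choiceType} {D : pred T}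
    (f : {x | D x} -> R[i]) (x : T) : R[i] :=
  if (insub x : option {x | D x}) is Some y then f y else 0.

Section Subtypes.
Context {R : realType} {T : choiceType} {D : pred T}.
Variable s : \bar R.
Hypothesis hs : (1 <= s)%E.
Implicit Types f : {x | D x} -> R[i].

Lemma ext0_val f y : ext0 f (val y) = f y.
Proof. by rewrite /ext0 valK. Qed.

Lemma ext0_out f x : ~~ D x -> ext0 f x = 0.
Proof. by move=> Dx; rewrite /ext0 insubN. Qed.

Lemma ext0_in f x (Dx : D x) : ext0 f x = f (exist _ x Dx).
Proof. by rewrite -[RHS]ext0_val. Qed.

Lemma set_bij_val : set_bij [set: {x | D x}] [set x | D x] val.
Proof.
split=> [y _ /=|y z _ _ /val_inj //|x Dx]; first exact: (valP y).
by exists (exist _ x Dx).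
Qed.

Lemma lnorm_restr (g : T -> R[i]) :
  (lnorm s (fun y : {x | D x} => g (val y)) <= lnorm s g)%E.
Proof.
have [->|[r r0 ->]] := exponentP hs.
  apply: ge_ereal_sup => _ [y _ <-]; by apply: ereal_sup_ubound; exists (val y).
apply: poweR_homo; first by rewrite invr_ge0 ltW.
  by apply: esum_ge0 => x _; rewrite lee_fin powR_ge0.
rewrite -(@reindex_esum _ _ _ _ _ _ (fun x => ((Normc.normc (g x)) `^ r)%:E) set_bij_val).
rewrite esum_mkcond; apply: le_esum => x _.
by case: ifP; rewrite // lee_fin powR_ge0.
Qed.

(** A point of the subtype is needed for the supremum norm, which is [-oo] on an
    empty type but [0] for the zero function on a nonempty one. *)
Lemma lnorm_ext0 (x0 : {x | D x}) f : lnorm s (ext0 f) = lnorm s f.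
Proof.
apply: le_anti; apply/andP; split; last first.
  have fE : f = (fun y => ext0 f (val y)) by apply/funext => y; rewrite ext0_val.
  by rewrite {1}fE; exact: lnorm_restr.
have [->|[r r0 ->]] := exponentP hs.
  apply: ge_ereal_sup => _ [x _ <-]; case: (boolP (D x)) => Dx.
    by rewrite ext0_in; apply: ereal_sup_ubound; exists (exist _ x Dx).
  rewrite ext0_out// Normc.normc0; apply: le_ereal_sup_tmp.
  by exists (Normc.normc (f x0))%:E; [exists x0|rewrite lee_fin normc_ge0].
apply: poweR_homo; first by rewrite invr_ge0 ltW.
  by apply: esum_ge0 => x _; rewrite lee_fin powR_ge0.
rewrite (_ : \esum_(x in [set: {x | D x}]) _ =
  \esum_(y in [set: {x | D x}]) ((Normc.normc (ext0 f (val y))) `^ r)%:E); last first.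
  by apply: eq_esum => y _; rewrite ext0_val.
rewrite -(@reindex_esum _ _ _ _ _ _ (fun x => ((Normc.normc (ext0 f x)) `^ r)%:E) set_bij_val).
rewrite [leRHS]esum_mkcond; apply: le_esum => x _.
case: ifPn => //; rewrite notin_setE /= => /negP Dx.
by rewrite ext0_out// Normc.normc0 powR0// gt_eqF.
Qed.

(** Turns a compression of [A], an operator on functions on the subtype, into [A]
    acting on functions that vanish outside [D]; from here on all compressions
    are studied on the fixed space of functions on [T]. *)
Lemma matop_sub (A : T -> T -> R[i]) f y :
  matop (fun x y : {x | D x} => A (val x) (val y)) f y = matop A (ext0 f) (val y).
Proof.
rewrite /matop -(@fsbig_widen _ _ _ _ [set x | D x]) //; last first.
  by move=> x [_ /= /negP Dx]; rewrite ext0_out// mulr0.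
rewrite (reindex_fsbig _ _ _ _ set_bij_val).
by apply: eq_fsbigr => z _; rewrite ext0_val.
Qed.

Lemma ell_ext0 (y0 : {x | D x}) f : ell s (ext0 f) <-> ell s f.
Proof. by rewrite /ell /= lnorm_ext0. Qed.

End Subtypes.

(** * Nonnegative row-finite matrices *)

Definition row_finite {R : realType} {T : choiceType} (A : T -> T -> R[i]) : Prop :=
  forall x, exists2 r : seq T, uniq r & forall y, A x y != 0 -> y \in r.

Section RowFinite.
Context {R : realType} {T : choiceType}.
Variable A : T -> T -> R[i].
Hypothesis Afin : row_finite A.
Implicit Types f g : T -> R[i].

Lemma matopE_supp (r : seq T) x f : uniq r -> (forall y, A x y * f y != 0 -> y \in r) ->
  matop A f x = \sum_(y <- r) A x y * f y.
Proof.
move=> ur Ar; rewrite /matop (@fsbigE _ _ _ _ _ r)//.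
  by apply: eq_bigl => y; rewrite in_setT.
by move=> y _; apply: contraNeq; exact: Ar.
Qed.

Lemma matopE (r : seq T) x f : uniq r -> (forall y, A x y != 0 -> y \in r) ->
  matop A f x = \sum_(y <- r) A x y * f y.
Proof.
move=> ur Ar; apply: matopE_supp => // y; rewrite mulf_eq0 negb_or => /andP[+ _].
exact: Ar.
Qed.

Lemma matop_comb (a : R[i]) f g x :
  matop A (fun y => a * f y + g y) x = a * matop A f x + matop A g x.
Proof.
have [r ur Ar] := Afin x; rewrite !(matopE _ ur Ar) big_distrr -big_split /=.
by apply: eq_bigr => y _; rewrite mulrDr mulrCA.
Qed.

Lemma matopD f g x : matop A (fun y => f y + g y) x = matop A f x + matop A g x.
Proof.
rewrite -[matop A f x]mul1r -matop_comb; congr matop.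
by apply/funext => y; rewrite mul1r.
Qed.

Lemma matop0 x : matop A (fun=> 0) x = 0.
Proof.
by have [r ur Ar] := Afin x; rewrite (matopE _ ur Ar) big1// => y _; rewrite mulr0.
Qed.

Lemma matopZ (a : R[i]) f x : matop A (fun y => a * f y) x = a * matop A f x.
Proof.
rewrite -[RHS]addr0 -[X in _ + X](matop0 x) -matop_comb; congr matop.
by apply/funext => y; rewrite addr0.
Qed.

Lemma matopB f g x : matop A (fun y => f y - g y) x = matop A f x - matop A g x.
Proof.
rewrite -[- matop A g x]mulN1r addrC -matop_comb; congr matop.
by apply/funext => y; rewrite mulN1r addrC.
Qed.

Hypothesis A0 : forall x y, 0 <= A x y.

Lemma matop_ge0 f x : (forall y, 0 <= f y) -> 0 <= matop A f x.
Proof.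
move=> f0; have [r ur Ar] := Afin x; rewrite (matopE _ ur Ar).
by apply: sumr_ge0 => y _; apply: mulr_ge0.
Qed.

Lemma matop_le f g x : (forall y, f y <= g y) -> matop A f x <= matop A g x.
Proof.
by move=> fg; rewrite -subr_ge0 -matopB; apply: matop_ge0 => y; rewrite subr_ge0.
Qed.

Lemma matop_norm f x : `|matop A f x| <= matop A (fun y => `|f y|) x.
Proof.
have [r ur Ar] := Afin x; rewrite !(matopE _ ur Ar) (le_trans (ler_norm_sum _ _ _))//.
by apply: ler_sum => y _; rewrite normrM (ger0_norm (A0 _ _)).
Qed.

Lemma matop_conj f x : matop A (fun y => (f y)^*) x = (matop A f x)^*.
Proof.
have [r ur Ar] := Afin x; rewrite !(matopE _ ur Ar) rmorph_sum /=.
apply: eq_bigr => y _; rewrite rmorphM /=; congr (_ * _).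
by apply/esym/CrealP; rewrite ger0_real.
Qed.

End RowFinite.

(** * Positivity of the resolvent below the spectral radius *)

Definition one_sub {R : realType} {T : choiceType} (A : T -> T -> R[i]) (t : R)
    (v : T -> R[i]) (x : T) : R[i] := v x - t%:C%C * matop A v x.

(** Bounded invertibility of [I - t A] with the bound [K] for the norm of the
    inverse, in the two parts that the arguments use: a lower bound, which also
    gives injectivity, and surjectivity. *)
Definition boundedly_invertible {R : realType} {T : choiceType} (s : \bar R)
    (A : T -> T -> R[i]) (t K : R) : Prop :=
  (forall v, ell s v -> (lnorm s v <= K%:E * lnorm s (one_sub A t v))%E) /\
  (forall f, ell s f -> exists2 v, ell s v & one_sub A t v = f).

(** The inverse of [I - t A] preserves nonnegativity; phrased without naming the
    inverse. *)
Definition inverse_positive {R : realType} {T : choiceType} (s : \bar R)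
    (A : T -> T -> R[i]) (t : R) : Prop :=
  forall v, ell s v -> (forall x, 0 <= one_sub A t v x) -> forall x, 0 <= v x.

Definition negpart {R : realType} {T : Type} (v : T -> R[i]) (x : T) : R[i] :=
  (`|v x| - v x) / 2.

Section NegativePart.
Context {R : realType} {T : choiceType}.
Implicit Type v : T -> R[i].

Lemma ell_negpart (s : \bar R) v : (1 <= s)%E -> ell s v -> ell s (negpart v).
Proof.
move=> hs ev; rewrite (_ : negpart v = fun x => 2^-1 * (`|v x| - v x)).
  by apply: ellZ => //; apply: ell_sub => //; exact: ell_abs.
by apply/funext => x; rewrite mulrC.
Qed.

Lemma negpartE v x : v x \is Num.real -> negpart v x = if 0 <= v x then 0 else - v x.
Proof.
rewrite realE /negpart => /orP[v0|v0]; first by rewrite v0 ger0_norm// subrr mul0r.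
case: ifPn => [v0'|]; first by rewrite ger0_norm// subrr mul0r.
by rewrite ler0_norm// => _; field.
Qed.

Lemma negpart_ge0 v x : v x \is Num.real -> 0 <= negpart v x.
Proof.
move=> rv; rewrite negpartE//; case: ifPn => //; move: rv; rewrite realE.
by move=> /orP[->|] //; rewrite oppr_ge0.
Qed.

Lemma addr_negpart_ge0 v x : v x \is Num.real -> 0 <= v x + negpart v x.
Proof. by move=> rv; rewrite negpartE//; case: ifP; rewrite ?addr0 ?subrr. Qed.

Lemma negpart_le0 v x : v x \is Num.real -> negpart v x <= 0 -> 0 <= v x.
Proof.
move=> rv; rewrite negpartE//; case: ifPn => // vx.
by rewrite oppr_le0 (negPf vx).
Qed.

End NegativePart.

Section InversePositivity.
Context {R : realType} {T : choiceType} (x0 : T).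
Variables (s : \bar R) (A : T -> T -> R[i]).
Hypothesis hs : (1 <= s)%E.
Hypothesis Afin : row_finite A.
Hypothesis A0 : forall x y, 0 <= A x y.
Implicit Types f g v : T -> R[i].

Lemma one_subB t v w x :
  one_sub A t (fun y => v y - w y) x = one_sub A t v x - one_sub A t w x.
Proof. by rewrite /one_sub matopB//; ring. Qed.

Lemma one_subD t v w x :
  one_sub A t (fun y => v y + w y) x = one_sub A t v x + one_sub A t w x.
Proof. by rewrite /one_sub matopD//; ring. Qed.

Lemma one_subZ t a v x : one_sub A t (fun y => a * v y) x = a * one_sub A t v x.
Proof. by rewrite /one_sub matopZ//; ring. Qed.

Lemma lnorm_zero : lnorm s (fun _ : T => 0 : R[i]) = 0%E.
Proof.
apply: le_anti; rewrite (lnorm_ge0 hs x0) andbT.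
have := @lnormZ R T s hs 0 (fun=> 0) (lexx _).
rewrite mul0e; congr (lnorm s _ <= _)%E.
by apply/funext => y; rewrite mulr0.
Qed.

Lemma lnorm_contract (c : R) (k : T -> R[i]) : 0 <= c -> c < 1 -> ell s k ->
  (lnorm s k <= c%:E * lnorm s k)%E -> forall x, k x = 0.
Proof.
move=> c0 c1 ek le x; have := lnorm_ge hs k x.
move: ek le; rewrite /ell /=; have := lnorm_ge0 hs x0 k.
case: (lnorm s k) => [a| |] //; rewrite !lee_fin => a0 _ le1 le2.
apply: Normc.eq0_normc; apply: le_anti; rewrite normc_ge0 andbT.
by apply: le_trans le2 _; nra.
Qed.

Lemma boundedly_invertible_inj t K v : boundedly_invertible s A t K -> ell s v ->
  (forall x, one_sub A t v x = 0) -> forall x, v x = 0.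
Proof.
move=> [bd _] ev v0; apply: (@lnorm_contract 0) => //.
have v0' : one_sub A t v = fun=> 0 by apply/funext.
by move: (bd v ev); rewrite v0' lnorm_zero mule0 mul0e.
Qed.

Lemma bounded_pos (F : (T -> R[i]) -> (T -> R[i])) : bounded_operator s F ->
  exists2 K : R, 0 < K & forall f, ell s f -> (lnorm s (F f) <= K%:E * lnorm s f)%E.
Proof.
move=> [_ [K KF]]; exists (Num.max K 1); first by rewrite lt_max ltr01 orbT.
move=> f ef; apply: le_trans (KF f ef) _; apply: lee_wpmul2r; first exact: lnorm_ge0.
by rewrite lee_fin le_max lexx.
Qed.

Lemma bounded_ell K (F : (T -> R[i]) -> (T -> R[i])) f :
  (forall f, ell s f -> (lnorm s (F f) <= K%:E * lnorm s f)%E) -> ell s f -> ell s (F f).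
Proof.
move=> KF ef; apply: le_lt_trans (KF f ef) _; move: ef; rewrite /ell /=.
by have := lnorm_ge0 hs x0 f; case: (lnorm s f) => [a| |] // _ _; rewrite ltry.
Qed.

Variable h : R.
Hypothesis h0 : 0 < h.
Hypothesis Abd : forall f, ell s f -> (lnorm s (matop A f) <= h%:E * lnorm s f)%E.

Lemma ell_matop f : ell s f -> ell s (matop A f).
Proof. exact: bounded_ell Abd. Qed.

(** For [t > 0] the number [1/t] exceeds the spectral radius in absolute value,
    so it is outside the spectrum, and [I - t A = t (1/t - A)]. *)
Lemma boundedly_invertible_of_radius (t : R) : 0 <= t ->
  (t%:E < (spectral_radius s (matop A))^-1)%E ->
  exists2 K, 0 < K & boundedly_invertible s A t K.
Proof.
rewrite le_eqVlt => /predU1P[<- _|t0 trho].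
  have E v : one_sub A 0 v = v by apply/funext => x; rewrite /one_sub mul0r subr0.
  exists 1 => //; split=> [v ev|f ef]; first by rewrite E mul1e.
  by exists f; rewrite ?E.
have : ~ spectrum s (matop A) (t^-1)%:C%C.
  move=> sp; have le : ((t^-1)%:E <= spectral_radius s (matop A))%E.
    apply: ereal_sup_ubound; exists (t^-1)%:C%C => //; congr _%:E.
    by apply: complexI; rewrite normcE_norm ger0_norm// ler0c invr_ge0 ltW.
  have r0 : (0 <= spectral_radius s (matop A))%E.
    by apply: le_trans le; rewrite lee_fin invr_ge0 ltW.
  move: trho; rewrite ltNge => /negP; apply.
  rewrite inve_ple ?inE //; last by rewrite lee_fin ltW.
  by rewrite inver gt_eqF.
move=> /contrapT [G [Gbd GI]]; have [K K0 KG] := bounded_pos Gbd.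
set z := (t^-1)%:C%C in GI *; have tz : t%:C%C * z = 1.
  by rewrite /z -rmorphM /= mulfV ?gt_eqF.
exists (K * t^-1); first by rewrite mulr_gt0 ?invr_gt0.
split=> [v ev|f ef].
  have [GE _] := GI v ev; have ezv : ell s (fun x => z * v x - matop A v x).
    by apply: ell_sub => //; [exact: ellZ | exact: ell_matop].
  have := KG _ ezv; rewrite GE => /le_trans; apply; rewrite EFinM -muleA.
  apply: lee_wpmul2l; first by rewrite lee_fin ltW.
  apply: le_trans (lnormZ hs (one_sub A t v) _); last by rewrite invr_ge0 ltW.
  apply: lnorm_le => // x; rewrite /one_sub -/z mulrBr [z * (t%:C%C * _)]mulrCA mulrA tz mul1r.
  exact: lexx.
have [_ GE] := GI _ (ellZ hs z ef).
exists (G (fun x => z * f x)); first by apply: bounded_ell KG _; exact: ellZ.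
apply/funext => x; have := congr1 (fun g => t%:C%C * g x) GE => /=.
by rewrite mulrBr !mulrA tz !mul1r.
Qed.

(** As [A] and [t] are real, [conj v - v] lies in the kernel of [I - t A]. *)
Lemma one_sub_real t K v : boundedly_invertible s A t K -> ell s v ->
  (forall x, one_sub A t v x \is Num.real) -> forall x, v x \is Num.real.
Proof.
move=> st ev rv x; apply/CrealP; apply/subr0_eq.
have ec : ell s (fun y => (v y)^*) by apply: ell_le ev => // y; rewrite norm_conjC.
apply: (boundedly_invertible_inj st (ell_sub hs ec ev)) => y.
rewrite one_subB; apply/eqP; rewrite subr_eq0; apply/eqP.
rewrite /one_sub matop_conj// -[RHS](CrealP (rv y)) /one_sub rmorphB rmorphM /=.
by congr (_ - _ * _); rewrite conj_Creal// complex_real.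
Qed.

(** Positivity passes from [t] to a larger [t'] when the distance is small
    compared with a bound [K0] on the inverse at a point [t0] in between.

    Let [(I - t' A) v >= 0] and let [n] be the negative part of [v], so that
    [v + n >= 0]. Put [e = t' - t] and solve [(I - t A) k = e A n]. Then [k >= 0]
    by positivity at [t], and [(I - t A) (v + k)] is the sum of [(I - t' A) v]
    and [e A (v + n)], hence nonnegative; thus [v + k >= 0], which means
    [n <= k]. On the other hand [(I - t0 A) k = A d] with
    [d = e n - (t0 - t) k], and [|d| <= e k] pointwise because [0 <= n <= k] and
    [0 <= t0 - t <= e]. Therefore [|k| <= K0 h e |k|] in norm, so [k = 0] and
    [n = 0]. The bound refers to the point [t0] and not to [t], so the step has
    the same length for all [t] near [t0]. *)
Lemma inverse_positive_step t0 t t' K0 K K' : 0 < K0 -> 0 <= t -> t <= t0 -> t0 <= t' ->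
  (t' - t) * h * K0 < 1 -> boundedly_invertible s A t0 K0 ->
  boundedly_invertible s A t K -> boundedly_invertible s A t' K' ->
  inverse_positive s A t -> inverse_positive s A t'.
Proof.
move=> K0p tp t_t0 t0_t' small st0 st st' pos v ev fv.
have rv : forall x, v x \is Num.real.
  by apply: (one_sub_real st' ev) => x; rewrite ger0_real.
pose n := negpart v; have en : ell s n by exact: ell_negpart.
have nE x : n x = if 0 <= v x then 0 else - v x by exact: negpartE.
have n0 x : 0 <= n x by exact: negpart_ge0.
have vn0 x : 0 <= v x + n x by exact: addr_negpart_ge0.
pose e := t' - t; have ed : 0 <= e by rewrite subr_ge0 (le_trans t_t0).
have e0 : 0 <= e%:C%C :> R[i] by rewrite ler0c.
have [k ek kE] := st.2 _ (ellZ hs e%:C%C (ell_matop en)).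
have kEx x : k x - t%:C%C * matop A k x = e%:C%C * matop A n x by have := congr1 (@^~ x) kE.
have k0 : forall x, 0 <= k x.
  apply: pos => // x; rewrite kE mulr_ge0//; exact: matop_ge0.
have nk x : n x <= k x.
  rewrite nE; case: ifPn => // _; rewrite -subr_ge0 opprK addrC.
  move: x; apply: pos; first exact: ell_add.
  move=> x; rewrite one_subD {2}/one_sub kEx.
  have -> : one_sub A t v x + e%:C%C * matop A n x =
            one_sub A t' v x + e%:C%C * matop A (fun y => v y + n y) x.
    by rewrite /one_sub matopD// /e rmorphB /=; ring.
  by rewrite addr_ge0// mulr_ge0//; exact: matop_ge0.
pose d x := e%:C%C * n x - (t0 - t)%:C%C * k x.
have tt0 : 0 <= (t0 - t)%:C%C :> R[i] by rewrite ler0c subr_ge0.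
have tt0e : (t0 - t)%:C%C <= e%:C%C :> R[i] by rewrite lecR lerB.
have dk x : `|d x| <= `|e%:C%C * k x|.
  rewrite (ger0_norm (mulr_ge0 e0 (k0 x))) real_ler_norml /d; last first.
    by rewrite realB// ger0_real// mulr_ge0.
  apply/andP; split.
    rewrite -subr_ge0 opprK addrAC -addrA; apply: addr_ge0; first exact: mulr_ge0.
    by rewrite -mulrBl mulr_ge0// subr_ge0.
  rewrite lerBlDr; apply: (@le_trans _ _ (e%:C%C * k x)); first exact: ler_wpM2l.
  by rewrite lerDl mulr_ge0.
have kd : one_sub A t0 k = matop A d.
  apply/funext => x; rewrite /d matopB// !matopZ// -kEx /one_sub rmorphB /=; ring.
have kz : forall x, k x = 0.
  apply: (@lnorm_contract (e * h * K0)) => //; first by rewrite !mulr_ge0// ltW.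
  have -> : e * h * K0 = K0 * (h * e) by ring.
  have ed' : ell s d.
    by apply: (ell_le hs dk); exact: ellZ.
  apply: le_trans (st0.1 _ ek) _; rewrite kd EFinM -muleA.
  apply: lee_wpmul2l; first by rewrite lee_fin ltW.
  apply: le_trans (Abd ed') _; rewrite EFinM -muleA.
  apply: lee_wpmul2l; first by rewrite lee_fin ltW.
  by apply: le_trans (lnormZ hs k ed); exact: lnorm_le.
move=> x; apply: negpart_le0 => //; rewrite -(kz x); exact: nk.
Qed.

(** The set of good parameters contains [0], and the step lemma around its
    supremum [t0] carries positivity from some [t <= t0] in the set to a
    [t' >= t0] which exceeds [t0] unless [t0 = tau]. *)
Lemma inverse_positive_upto tau : 0 <= tau ->
  (forall t, 0 <= t -> t <= tau -> exists2 K, 0 < K & boundedly_invertible s A t K) ->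
  inverse_positive s A tau.
Proof.
move=> tau0 st; pose E := [set t : R | [/\ 0 <= t, t <= tau & inverse_positive s A t]].
have E0 : E 0.
  by split=> // v _ v0 x; have := v0 x; rewrite /one_sub mul0r subr0.
have supE : has_sup E by split; [exists 0 | exists tau => t []].
pose t0 := sup E.
have t00 : 0 <= t0 by apply: ub_le_sup => //; exact: supE.2.
have t0tau : t0 <= tau by apply: ge_sup; [exists 0 | move=> t []].
have [K0 K0p st0] := st _ t00 t0tau.
(* Both t and t' are within d of t0, so (t' - t) h K0 is below 1/2. *)
pose d := (4 * (h * K0))^-1; have hK : 0 < h * K0 by exact: mulr_gt0.
have d0 : 0 < d by rewrite invr_gt0 mulr_gt0.
have dE : d * (h * K0) = 4^-1 by rewrite /d invfM mulfVK// gt_eqF.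
have [t [tp tt post] td] : exists2 t, E t & t0 - d < t by exact: sup_adherent.
have tt0 : t <= t0 by apply: ub_le_sup => //; exact: supE.2.
pose t' := Num.min tau (t0 + d).
have t0t' : t0 <= t' by rewrite le_min t0tau lerDl ltW.
have t't : t' <= t0 + d by rewrite ge_min lexx orbT.
have t'tau : t' <= tau by rewrite ge_min lexx.
have [K _ stt] := st _ tp tt.
have [K' _ st'] := st _ (le_trans t00 t0t') t'tau.
have pos' : inverse_positive s A t'.
  apply: (inverse_positive_step K0p tp tt0 t0t' _ st0 stt st' post).
  by rewrite -mulrA; nra.
have t't0 : t' <= t0.
  by apply: ub_le_sup; [exact: supE.2 | split=> //; exact: le_trans t0t'].
suff <- : t' = tau by [].
rewrite /t'; case: leP => // lt; move: t't0; rewrite /t' (min_idPr (ltW lt)).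
by rewrite leNgt ltrDl d0.
Qed.

End InversePositivity.

(** * Monotone limits *)

Section MonotoneLimits.
Context {R : realType} {T : choiceType}.

Lemma cvg_real_complex (u : nat -> R) (l : R) : u @ \oo --> l ->
  (fun n => (u n)%:C%C : R[i]^o) @ \oo --> (l%:C%C : R[i]^o).
Proof.
move=> ul; apply/cvgrPdist_lt => e e0.
have er : e = (complex.Re e)%:C%C by rewrite RRe_real// ger0_real// ltW.
have {}e0 : 0 < complex.Re e by rewrite -ltcR -er.
near=> n; rewrite -rmorphB normc_def /= expr0n addr0 sqrtr_sqr er ltcR.
by near: n; move/cvgrPdist_lt : ul; exact.
Unshelve. all: by end_near. Qed.

Lemma monotone_cvg (u : nat -> R[i]) (b : R[i]) :
  (forall n, 0 <= u n) -> (forall n, u n <= u n.+1) -> (forall n, u n <= b) ->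
  exists l : R[i], [/\ (u : nat -> R[i]^o) @ \oo --> (l : R[i]^o), 0 <= l & l <= b].
Proof.
move=> u0 uS ub; pose r n := complex.Re (u n).
have rE n : u n = (r n)%:C%C by rewrite RRe_real// ger0_real.
have b0 : 0 <= b := le_trans (u0 0%N) (ub 0%N).
have bE : b = (complex.Re b)%:C%C by rewrite RRe_real// ger0_real.
have rS : nondecreasing_seq r.
  by apply/nondecreasing_seqP => n; rewrite -lecR -!rE.
have rb : has_ubound (range r).
  by exists (complex.Re b) => _ [n _ <-]; rewrite -lecR -rE -bE.
have rl := nondecreasing_cvgn rS rb.
exists (sup (range r))%:C%C; split.
- rewrite (_ : u = fun n => (r n)%:C%C); last by apply/funext.
  exact: cvg_real_complex.
- rewrite ler0c; apply: (@le_trans _ _ (r 0%N)); first by rewrite -ler0c -rE.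
  by apply: ub_le_sup => //; exists 0%N.
- rewrite bE lecR; apply: ge_sup; first by exists (r 0%N); exists 0%N.
  by move=> _ [n _ <-]; rewrite -lecR -rE -bE.
Qed.

Lemma cvg_scaled (a l : R[i]) (u : nat -> R[i]) :
  (u : nat -> R[i]^o) @ \oo --> (l : R[i]^o) ->
  (fun n => a * u n : R[i]^o) @ \oo --> (a * l : R[i]^o).
Proof. by apply: (@cvgM R[i]); exact: cvg_cst. Qed.

Lemma cvg_matop (A : T -> T -> R[i]) (Afin : row_finite A) (u : nat -> T -> R[i]) v x :
  (forall y, (fun n => u n y : R[i]^o) @ \oo --> (v y : R[i]^o)) ->
  (fun n => matop A (u n) x : R[i]^o) @ \oo --> (matop A v x : R[i]^o).
Proof.
move=> uv; have [r ur Ar] := Afin x; rewrite (matopE _ ur Ar).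
rewrite (_ : (fun n => _) = fun n => \sum_(y <- r) A x y * u n y); last first.
  by apply/funext => n; rewrite (matopE _ ur Ar).
elim: (r) => [|y r' IH].
  by under eq_fun do rewrite big_nil; rewrite big_nil; exact: cvg_cst.
under eq_fun do rewrite big_cons; rewrite big_cons.
apply: (@cvgD _ R[i]^o); last exact: IH.
by apply: cvg_scaled; exact: uv.
Qed.

(** The limit also commutes with [A] because each row of [A] is a finite sum. The
    hypothesis on [g] gives, through [ell_le], membership of the limit in any
    space [ell s] that contains [g]. *)
Lemma monotone_family_cvg (A : T -> T -> R[i]) (Afin : row_finite A)
    (u : nat -> T -> R[i]) (g : T -> R[i]) :
  (forall n x, 0 <= u n x) -> (forall n x, u n x <= u n.+1 x) -> (forall n x, u n x <= g x) ->
  exists w : T -> R[i], [/\ forall x, 0 <= w x <= g x,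
    forall x, (fun n => u n x : R[i]^o) @ \oo --> (w x : R[i]^o) &
    forall x, (fun n => matop A (u n) x : R[i]^o) @ \oo --> (matop A w x : R[i]^o)].
Proof.
move=> u0 uS ug.
have /choice [w wP] x := monotone_cvg (u0^~ x) (uS^~ x) (ug^~ x).
exists w; split=> x; first by have [_ -> ->] := wP x.
  by have [] := wP x.
by apply: cvg_matop => // y; have [] := wP y.
Qed.

End MonotoneLimits.

(** * Compressions to subsets of the index set *)

(** [v] is the solution, extended by zero, of the equation [(I - t A_D) v = f] for
    the compression [A_D] of [A] to [D]. *)
Definition solves {R : realType} {T : choiceType} (A : T -> T -> R[i]) (t : R)
    (D : pred T) (f v : T -> R[i]) : Prop :=
  (forall x, ~~ D x -> v x = 0) /\ (forall x, D x -> one_sub A t v x = f x).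

Section Compressions.
Context {R : realType} {T : choiceType} (x0 : T).
Variables (s : \bar R) (A : T -> T -> R[i]) (t K : R).
Hypothesis hs : (1 <= s)%E.
Hypothesis Afin : row_finite A.
Hypothesis A0 : forall x y, 0 <= A x y.
Hypothesis t0 : 0 <= t.
Hypothesis st : boundedly_invertible s A t K.
Hypothesis pos : inverse_positive s A t.
Implicit Types (D : pred T) (f g v w : T -> R[i]).

Let tC : 0 <= t%:C%C :> R[i]. Proof. by rewrite ler0c. Qed.

(** Compressions inherit inverse positivity. The negative part [n] of [d] vanishes
    outside [D] and satisfies [n <= t A n] everywhere, so [- n] is nonnegative by
    positivity of the full inverse. All uniqueness and comparison statements for
    compressions follow from this lemma. *)
Lemma compression_positive D d : ell s d -> (forall x, d x \is Num.real) ->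
  (forall x, ~~ D x -> 0 <= d x) -> (forall x, D x -> 0 <= one_sub A t d x) ->
  forall x, 0 <= d x.
Proof.
move=> ed rd dout din x.
have n0 y : 0 <= negpart d y by exact: negpart_ge0.
have := @pos (fun x => -1 * negpart d x) _ _ x.
rewrite mulN1r oppr_ge0 => np; apply: (negpart_le0 (rd x)); apply: np.
  by apply: ellZ => //; exact: ell_negpart.
move=> y; rewrite one_subZ// mulN1r oppr_ge0 subr_le0 negpartE//.
case: ifPn => [_|dy]; first by rewrite mulr_ge0// matop_ge0.
have Dy : D y by apply: contraNT dy => /dout.
have := din _ Dy; rewrite /one_sub subr_ge0 => le; rewrite lerNl; apply: le_trans _ le.
rewrite -mulrN ler_wpM2l// -[- _]mulN1r -matopZ//.
apply: matop_le => // z; rewrite mulN1r lerNl negpartE//; case: ifPn => //.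
by rewrite oppr_le0.
Qed.

Lemma solves_comb D c f g v w : solves A t D f v -> solves A t D g w ->
  solves A t D (fun x => c * f x + g x) (fun x => c * v x + w x).
Proof.
move=> [vo vi] [wo wi]; split=> x Dx; first by rewrite vo// wo// mulr0 addr0.
by rewrite one_subD// one_subZ// vi// wi.
Qed.

Lemma solves_sum D (r : seq T) (a : T -> R[i]) (g v : T -> T -> R[i]) :
  (forall z, z \in r -> ell s (v z) /\ solves A t D (g z) (v z)) ->
  ell s (fun x => \sum_(z <- r) a z * v z x) /\
  solves A t D (fun x => \sum_(z <- r) a z * g z x) (fun x => \sum_(z <- r) a z * v z x).
Proof.
elim: r => [_|y r IH vP].
  have E (f : T -> T -> R[i]) : (fun x => \sum_(z <- [::]) a z * f z x) = fun=> 0.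
    by apply/funext => x; rewrite big_nil.
  rewrite !E; split; first exact: (ell_finite_support hs (r := [::])).
  by split=> x Dx //; rewrite /one_sub matop0// mulr0 subr0.
have [ev sv] := vP y (mem_head _ _).
have [es ss] := IH (fun z zr => vP z (mem_behead (s := y :: r) zr)).
have E (f : T -> T -> R[i]) : (fun x => \sum_(z <- y :: r) a z * f z x) =
    (fun x => a y * f y x + \sum_(z <- r) a z * f z x).
  by apply/funext => x; rewrite big_cons.
rewrite !E; split; last exact: solves_comb.
by apply: ell_add => //; exact: ellZ.
Qed.

(** The function [- |v - w|] satisfies the hypotheses of [compression_positive],
    because [|v - w| <= t A |v - w|] on [D]. *)
Lemma solves_unique D f v w : ell s v -> ell s w ->
  solves A t D f v -> solves A t D f w -> v = w.
Proof.
move=> ev ew [vo vi] [wo wi]; pose d x := `|v x - w x|.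
have ed : ell s d by apply: ell_abs => //; exact: ell_sub.
have rd x : -1 * d x \is Num.real by rewrite mulN1r rpredN normr_real.
have dP : forall x, 0 <= -1 * d x.
  apply: (compression_positive (D := D) (ellZ hs _ ed) rd) => x Dx.
    by rewrite /d vo// wo// subrr normr0 mulr0.
  rewrite one_subZ// mulN1r oppr_ge0 subr_le0 /d.
  have -> : v x - w x = t%:C%C * matop A (fun y => v y - w y) x.
    apply/eqP; rewrite -subr_eq0; apply/eqP.
    by rewrite -[LHS]/(one_sub A t (fun y => v y - w y) x) one_subB// vi// wi// subrr.
  by rewrite normrM (ger0_norm tC) ler_wpM2l// matop_norm.
apply/funext => x; apply/subr0_eq/eqP; rewrite -normr_le0.
by have := dP x; rewrite mulN1r oppr_ge0.
Qed.

(** The norm of the inverse of a compression is bounded by that of the full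
    inverse: the full solution with right-hand side [|f|] dominates [|v|]. *)
Lemma solves_bound D f v : ell s f -> ell s v -> solves A t D f v ->
  (lnorm s v <= K%:E * lnorm s f)%E.
Proof.
move=> ef ev [vo vi]; have [g eg gE] := st.2 _ (ell_abs hs ef).
have gEx x : one_sub A t g x = `|f x| by rewrite gE.
have g0 : forall x, 0 <= g x by apply: pos => // x; rewrite gE.
have vg x : `|v x| <= g x.
  rewrite -subr_ge0; move: x.
  apply: (@compression_positive D (fun x => g x - `|v x|)).
  - by apply: ell_sub => //; exact: ell_abs.
  - by move=> x; rewrite realB ?normr_real ?ger0_real.
  - by move=> x Dx; rewrite vo// normr0 subr0.
  move=> x Dx; rewrite one_subB// gEx -(vi _ Dx) /one_sub subr_ge0.
  rewrite lerBlDr; have {1}-> : v x = (v x - t%:C%C * matop A v x) + t%:C%C * matop A v x.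
    by rewrite subrK.
  apply: le_trans (ler_normD _ _) _; rewrite lerD2l normrM (ger0_norm tC).
  by rewrite ler_wpM2l// matop_norm.
apply: (@le_trans _ _ (lnorm s g)).
  by apply: lnorm_le => // x; rewrite (ger0_norm (g0 x)).
by apply: le_trans (st.1 _ eg) _; rewrite gE lnorm_abs.
Qed.

(** The Neumann iterates increase, and the solution of the full equation bounds
    them. *)
Lemma solves_exists_ge0 D f : ell s f -> (forall x, 0 <= f x) ->
  exists v, [/\ ell s v, forall x, 0 <= v x & solves A t D f v].
Proof.
move=> ef f0; have [g eg gE] := st.2 _ ef.
have g0 : forall x, 0 <= g x by apply: pos => // x; rewrite gE.
have gEx x : g x = f x + t%:C%C * matop A g x by rewrite -gE subrK.
(* The Neumann iteration is u, with u (n + 1) = F (u n) and u 0 = 0. *)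
pose F w x := if D x then f x + t%:C%C * matop A w x else 0.
have Fle v w : (forall x, v x <= w x) -> forall x, F v x <= F w x.
  by move=> vw x; rewrite /F; case: ifP => // _; rewrite lerD2l ler_wpM2l// matop_le.
have Fg x : F g x <= g x by rewrite /F; case: ifP => // _; rewrite -gEx.
pose u n := iter n F (fun=> 0).
have u0 n x : 0 <= u n x.
  case: n => [|n] //=; rewrite /F; case: ifP => // _.
  elim: n x => [|n IH] x.
    by rewrite matop0// mulr0 addr0.
  rewrite addr_ge0// mulr_ge0// matop_ge0// => y /=.
  by rewrite /F; case: ifP.
have uS n x : u n x <= u n.+1 x.
  elim: n x => [|n IH] x; first exact: u0 1%N x.
  by rewrite /= Fle.
have ug n x : u n x <= g x.
  by elim: n x => [|n IH] x //; apply: le_trans (Fg x); exact: Fle.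
have [w [wg uw Auw]] := monotone_family_cvg Afin u0 uS ug.
have w0 x : 0 <= w x by have /andP[] := wg x.
have ew : ell s w.
  apply: ell_le eg => // x; rewrite !ger0_norm//.
  by have /andP[] := wg x.
have wF x : w x = F w x.
  apply: (@cvg_unique R[i]^o (@norm_hausdorff _ _)
     ((fun n => u n.+1 x : R[i]^o) @ \oo)).
    by have := uw x; rewrite -cvg_shiftS.
  rewrite /= /F; case: ifP => _; last exact: cvg_cst.
  apply: (@cvgD _ R[i]^o); first exact: cvg_cst.
  by apply: cvg_scaled; exact: Auw.
exists w; split=> //; split=> x Dx; rewrite /one_sub wF /F; first by rewrite (negPf Dx).
by rewrite Dx; ring.
Qed.

(** A complex [f] is the combination [i (Im f + |f|) - (1 + i) |f| + (Re f + |f|)]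
    of three nonnegative elements of [ell s]. *)
Lemma solves_exists D f : ell s f -> exists2 v, ell s v & solves A t D f v.
Proof.
move=> ef; have ea := ell_abs hs ef.
pose fr x := 'Re (f x) + `|f x|; pose fi x := 'Im (f x) + `|f x|.
have le x : `|'Re (f x)| <= `|f x| by rewrite leif_normC_Re_Creal.
have lei x : `|'Im (f x)| <= `|f x|.
  have := leif_normC_Re_Creal ('i * f x); rewrite ReMil normrN normrM normCi mul1r.
  by move=> ->.
have er : ell s fr.
  by apply: ell_add => //; apply: ell_le ea => // x; rewrite normr_id.
have ei : ell s fi.
  by apply: ell_add => //; apply: ell_le ea => // x; rewrite normr_id.
have fr0 x : 0 <= fr x.
  by rewrite /fr -lerBlDr sub0r; have := le x; rewrite real_ler_norml ?Creal_Re// => /andP[].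
have fi0 x : 0 <= fi x.
  by rewrite /fi -lerBlDr sub0r; have := lei x; rewrite real_ler_norml ?Creal_Im// => /andP[].
have [vr [evr _ sr]] := solves_exists_ge0 D er fr0.
have [vi [evi _ si]] := solves_exists_ge0 D ei fi0.
have [va [eva _ sa]] := solves_exists_ge0 D ea (fun x => normr_ge0 _).
have S := solves_comb 'i si (solves_comb (- (1 + 'i)) sa sr).
exists (fun x => 'i * vi x + (- (1 + 'i) * va x + vr x)).
  by apply: ell_add => //; [exact: ellZ | apply: ell_add => //; exact: ellZ].
move: S; congr (solves _ _ _ _ _); apply/funext => x.
by rewrite [RHS]Crect /fi /fr; ring.
Qed.

Lemma solves_ge0 D f v : ell s f -> (forall x, 0 <= f x) -> ell s v -> solves A t D f v ->
  forall x, 0 <= v x.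
Proof.
move=> ef f0 ev sv; have [w [ew w0 sw]] := solves_exists_ge0 D ef f0.
by rewrite (solves_unique ev ew sv sw).
Qed.

(** A nonnegative supersolution dominates the solution. *)
Lemma solves_le D f v y : ell s v -> ell s y -> (forall x, 0 <= v x) -> (forall x, 0 <= y x) ->
  solves A t D f v -> (forall x, D x -> f x <= one_sub A t y x) -> forall x, v x <= y x.
Proof.
move=> ev ey v0 y0 [vo vi] yf x; rewrite -subr_ge0; move: x.
apply: (@compression_positive D (fun x => y x - v x)).
- exact: ell_sub.
- by move=> x; rewrite realB ?ger0_real.
- by move=> x Dx; rewrite vo// subr0.
- by move=> x Dx; rewrite one_subB// vi// subr_ge0 yf.
Qed.

Lemma solves_mono D D' f v v' : (forall x, D x -> D' x) -> ell s f -> (forall x, 0 <= f x) ->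
  ell s v -> ell s v' -> solves A t D f v -> solves A t D' f v' -> forall x, v x <= v' x.
Proof.
move=> DD' ef f0 ev ev' sv sv'; have v0 := solves_ge0 ef f0 ev sv.
have v0' := solves_ge0 ef f0 ev' sv'.
by apply: (solves_le ev ev' v0 v0' sv) => x /DD' Dx; rewrite sv'.2.
Qed.

(** Solutions on an exhausting sequence of subsets increase and stay below [v].
    Their limit lies in [ell s] and solves the equation on [D], since each
    coordinate of the equation involves finitely many terms and holds from some
    index on; uniqueness identifies the limit with [v]. *)
Lemma solves_cvg (Dn : nat -> pred T) D f (vn : nat -> T -> R[i]) v :
  ell s f -> (forall x, 0 <= f x) ->
  (forall n x, Dn n x -> Dn n.+1 x) -> (forall n x, Dn n x -> D x) ->
  (forall x, D x -> \forall n \near \oo, Dn n x) ->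
  (forall n, ell s (vn n)) -> (forall n, solves A t (Dn n) f (vn n)) ->
  ell s v -> solves A t D f v ->
  forall x, (fun n => vn n x : R[i]^o) @ \oo --> (v x : R[i]^o).
Proof.
move=> ef f0 Dn1 DnD Dnear evn svn ev sv.
have vn0 n : forall x, 0 <= vn n x := solves_ge0 ef f0 (evn n) (svn n).
have vn1 n : forall x, vn n x <= vn n.+1 x.
  exact: (solves_mono (Dn1 n) ef f0 (evn _) (evn _) (svn _) (svn _)).
have vnv n : forall x, vn n x <= v x.
  exact: (solves_mono (DnD n) ef f0 (evn _) ev (svn _) sv).
have [w [wv uw Auw]] := monotone_family_cvg Afin vn0 vn1 vnv.
suff -> : v = w by [].
have ew : ell s w.
  by apply: ell_le ev => // x; have /andP[w0 wx] := wv x; rewrite !ger0_norm// (le_trans w0).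
apply: (solves_unique ev ew sv); split=> x Dx.
  by apply: le_anti; have /andP[-> wx] := wv x; rewrite andbT -(sv.1 x Dx).
apply: (@cvg_unique R[i]^o (@norm_hausdorff _ _)
   ((fun n => one_sub A t (vn n) x : R[i]^o) @ \oo)).
  apply: (@cvgB _ R[i]^o); first exact: uw.
  by apply: cvg_scaled; exact: Auw.
apply: (@cvg_trans _ ((fun=> f x : R[i]^o) @ \oo)); last exact: cvg_cst.
apply: near_eq_cvg; have := Dnear x Dx; apply: filterS => n Dnx.
by rewrite (svn n).2.
Qed.

End Compressions.

(** * The bounded inverse of a compression *)

Section SubtypeInverse.
Context {R : realType} {T : choiceType} {D : pred T} (y0 : {x | D x}).
Variables (s : \bar R) (A : T -> T -> R[i]) (t K : R).
Hypothesis hs : (1 <= s)%E.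
Hypothesis Afin : row_finite A.
Hypothesis A0 : forall x y, 0 <= A x y.
Hypothesis t0 : 0 <= t.
Hypothesis st : boundedly_invertible s A t K.
Hypothesis pos : inverse_positive s A t.
Variable h : R.
Hypothesis Abd : forall f, ell s f -> (lnorm s (matop A f) <= h%:E * lnorm s f)%E.
Implicit Types f v : {x | D x} -> R[i].

Let F f (x : {x | D x}) := f x - t%:C%C * matop (fun x y : {x | D x} => A (val x) (val y)) f x.

(** Translates the equation for the operator on the subtype into the language of
    [solves]. *)
Lemma solves_ext0 f v : solves A t D (ext0 f) (ext0 v) <-> F v = f.
Proof.
split=> [[_ vi]|<-].
  apply/funext => x; have := vi (val x) (valP x).
  by rewrite /one_sub !ext0_val /F matop_sub.
split=> x Dx; first by rewrite ext0_out.
by rewrite [RHS]ext0_in /F matop_sub /one_sub !ext0_in.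
Qed.

Lemma compression_inj v w : ell s v -> ell s w -> F v = F w -> v = w.
Proof.
move=> /(ell_ext0 hs y0) ev /(ell_ext0 hs y0) ew E.
have E' : ext0 v = ext0 w :> (T -> _).
  apply: (solves_unique hs Afin A0 t0 pos ev ew (D := D) (f := ext0 (F w))).
    by apply/solves_ext0.
  by apply/solves_ext0.
apply/funext => x; by have := congr1 (@^~ (val x)) E'; rewrite !ext0_val.
Qed.

Lemma compression_invertible : invertible s F.
Proof.
have /choice [G GP] f : exists g, ell s f -> [/\ ell s g, F g = f &
    (lnorm s g <= K%:E * lnorm s f)%E].
  have [ef|nef] := pselect (ell s f); last by exists f.
  have /(ell_ext0 hs y0) ef' := ef.
  have [v ev sv] := solves_exists hs Afin A0 t0 st pos D ef'.
  have vE : v = ext0 (fun x : {x | D x} => v (val x)).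
    apply/funext => x; case: (boolP (D x)) => Dx; first by rewrite ext0_in.
    by rewrite ext0_out// sv.1.
  exists (fun x => v (val x)) => _; split.
  - by apply/(ell_ext0 hs y0); rewrite -vE.
  - by apply/solves_ext0; rewrite -vE.
  rewrite -(lnorm_ext0 hs y0) -vE -(lnorm_ext0 hs y0 f).
  exact: (solves_bound hs Afin A0 t0 st pos ef' ev sv).
have Fcomb a v w x : F (fun y => a * v y + w y) x = a * F v x + F w x.
  have Afin' : row_finite (fun x y : {x | D x} => A (val x) (val y)).
    move=> z; have [r ur Ar] := Afin (val z).
    by exists (pmap insub r); [exact: pmap_sub_uniq | move=> y /Ar; rewrite mem_pmap_sub].
  by rewrite /F matop_comb//; ring.
exists G; split; [split | move=> f ef].
- move=> a f g ef eg; have [eGf Gf _] := GP f ef; have [eGg Gg _] := GP g eg.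
  have efg : ell s (fun x => a * f x + g x) by apply: ell_add => //; exact: ellZ.
  have [eGfg Gfg _] := GP _ efg.
  apply: compression_inj => //; first by apply: ell_add => //; exact: ellZ.
  by rewrite Gfg; apply/funext => x; rewrite Fcomb Gf Gg.
- by exists K => f ef; have [] := GP f ef.
have [eGf Gf _] := GP f ef.
have eF : ell s (F f).
  apply: ell_sub => //; apply: ellZ => //.
  have eAf : ell s (fun x : {x | D x} => matop A (ext0 f) (val x)).
    apply: le_lt_trans (lnorm_restr hs _) _; apply: (ell_matop (val y0) hs Abd).
    exact/(ell_ext0 hs y0).
  by apply: ell_le eAf => // x; rewrite matop_sub.
have [eG2 G2 _] := GP _ eF.
by split=> //; apply: compression_inj.
Qed.

Lemma opinv_solves (y : {x | D x}) : let v := ext0 (opinv s F (unit_vec y)) in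
  ell s v /\ solves A t D (unit_vec (val y)) v.
Proof.
move=> v; have [[_ [C GC]] GI] := xgetPex (fun f => f) compression_invertible.
rewrite -/(opinv s F) in GC GI.
have ee : ell s (unit_vec y).
  by apply: (@ell_finite_support _ _ _ hs [:: y]) => z; rewrite inE /unit_vec => /negPf ->.
have eG : ell s (opinv s F (unit_vec y)) by exact: (bounded_ell y0 hs GC).
split; first exact/(ell_ext0 hs y0).
have -> : unit_vec (val y) = ext0 (unit_vec y) :> (T -> R[i]).
  apply/funext => x; case: (boolP (D x)) => Dx.
    by rewrite ext0_in /unit_vec -(inj_eq val_inj).
  by rewrite ext0_out// /unit_vec; case: eqP => // xE; move: Dx; rewrite xE (valP y).
by apply/solves_ext0; have [] := GI _ ee.
Qed.

End SubtypeInverse.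

(** * Height blocks *)

Section IndexSets.
Context {p q : nat}.
Local Notation hidx := (hidx p q).
Local Notation w := (width p q).

Lemma mem_hrange a b (x : hidx) : (x \in hrange p q a b) = (a <= height x < b)%N.
Proof.
rewrite mem_pmap_sub; apply/allpairsP/idP => [[[h j] /= [hin _ xE]]|hx].
  have hE : height x = h := congr1 fst xE.
  by move: hin; rewrite mem_iota hE; lia.
exists (val x) => /=; split; last by case: (val x).
  rewrite -/(height x) mem_iota; lia.
exact: mem_enum.
Qed.

Lemma hrange_uniq a b : uniq (hrange p q a b).
Proof.
apply: pmap_sub_uniq; apply: allpairs_uniq; [exact: iota_uniq | exact: enum_uniq |].
by move=> [a1 a2] [b1 b2] _ _.
Qed.

Lemma mem_V k (x : hidx) : (x \in V p q k) = (k * w <= height x < k.+1 * w)%N.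
Proof. exact: mem_hrange. Qed.

Lemma mem_Vseg m N (x : hidx) : (x \in Vseg p q m N) = (m * w <= height x < N.+1 * w)%N.
Proof. exact: mem_hrange. Qed.

Lemma V_height k (x : hidx) : x \in V p q k -> (height x %/ w)%N = k.
Proof.
rewrite mem_V => /andP[kx xk]; have w0 : (0 < w)%N.
  by move: (leq_ltn_trans kx xk); rewrite ltn_mul2r => /andP[].
by apply/eqP; rewrite eqn_leq -ltnS ltn_divLR// xk leq_divRL.
Qed.

Lemma V_inj k k' (x : hidx) : x \in V p q k -> x \in V p q k' -> k = k'.
Proof. by move=> /V_height <- /V_height <-. Qed.

Lemma V_block m (x : hidx) : (0 < w)%N -> (m * w <= height x)%N ->
  exists2 k, (m <= k)%N & x \in V p q k.
Proof.
move=> w0 mx; exists (height x %/ w)%N; first by rewrite leq_divRL.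
by rewrite mem_V leq_divM ltn_ceil.
Qed.

End IndexSets.

Section Submatrices.
Context {p q : nat} {K : pzRingType}.
Local Notation hidx := (hidx p q).
Implicit Types (G H : hidx -> hidx -> K) (r c d : seq hidx).

Lemma submatP G H r c : submat G r c = submat H r c <->
  (forall x y, x \in r -> y \in c -> G x y = H x y).
Proof.
split=> [/matrixP E x y xr yc|E].
  have /tnthP[i ->] : x \in in_tuple r by [].
  have /tnthP[j ->] : y \in in_tuple c by [].
  by have := E i j; rewrite !mxE.
by apply/matrixP => i j; rewrite !mxE E ?mem_tnth.
Qed.

Lemma submat_mul G H r c d :
  submat G r c *m submat H c d = submat (fun x y => \sum_(z <- c) G x z * H z y) r d.
Proof.
apply/matrixP => i j; rewrite !mxE [RHS]big_tnth.
by apply: eq_bigr => k _; rewrite !mxE.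
Qed.

Lemma submat1 r : uniq r -> 1%:M = submat (fun x y => (x == y)%:R : K) r r.
Proof.
move=> ur; apply/matrixP => i j; rewrite !mxE; congr (_%:R).
have [x0 xE] : exists x0, forall k, tnth (in_tuple r) k = nth x0 r k.
  by exists (tnth (in_tuple r) i) => k; exact: tnth_nth.
by rewrite !xE nth_uniq.
Qed.

End Submatrices.

(** * The block equations as one equation on functions *)

Section BlockEquations.
Context {R : realType} {p q : nat}.
Context {l : 'I_p -> nat -> R[i]} {u : 'I_q -> nat -> R[i]}.
Local Notation hidx := (hidx p q).
Local Notation V := (V p q).
Local Notation w := (width p q).
Local Notation H := (hmat l u).
Implicit Types (x y c : hidx) (G : hidx -> hidx -> R[i]).

(** One step of the matrix changes the height by at most the width of a block:
    this is block tridiagonality. *)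
Lemma hmat_band x y : H x y != 0 ->
  (height y <= height x + w)%N /\ (height x <= height y + w)%N.
Proof.
rewrite /hmat; case: ifP => [_|_]; first by rewrite eqxx.
have wP : (Pred p q <= w)%N by exact: leq_maxl.
have wQ : (Qred p q <= w)%N by exact: leq_maxr.
have [->|_] := height y =P (height x + Qred p q)%N; first by lia.
by have [<-|_] := (height y + Pred p q)%N =P height x; [lia | rewrite eqxx].
Qed.

Lemma hmat_row_finite : row_finite H.
Proof.
move=> x; exists (hrange p q 0 (height x + w).+1); first exact: hrange_uniq.
by move=> y /hmat_band[h1 _]; rewrite mem_hrange; lia.
Qed.

Lemma matop_first_block m f x : x \in V m -> (forall y, (height y < m * w)%N -> f y = 0) ->
  matop H f x = \sum_(y <- V m) H x y * f y + \sum_(y <- V m.+1) H x y * f y.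
Proof.
rewrite mem_V => xm f0; rewrite -big_cat; apply: matopE_supp.
  rewrite cat_uniq !hrange_uniq andbT /=; apply/hasPn => y.
  by rewrite /= !mem_hrange; lia.
move=> y; rewrite mulf_eq0 negb_or => /andP[/hmat_band[h1 h2] fy].
have : (m * w <= height y)%N by rewrite leqNgt; apply: contraNN fy => /f0 ->.
by rewrite mem_cat !mem_hrange; lia.
Qed.

Lemma matop_later_block k f x : x \in V k.+1 ->
  matop H f x = \sum_(y <- V k) H x y * f y + \sum_(y <- V k.+1) H x y * f y
                + \sum_(y <- V k.+2) H x y * f y.
Proof.
rewrite mem_V => xk; rewrite -!big_cat; apply: matopE.
  rewrite !cat_uniq !hrange_uniq !andbT /=; apply/andP; split; apply/hasPn => y.
    by rewrite /= !mem_hrange; lia.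
  by rewrite /= mem_cat !mem_hrange; lia.
by move=> y /hmat_band[h1 h2]; rewrite !mem_cat !mem_hrange; lia.
Qed.

(** For blocks cut out of one function [G] of two indices, the first block equation
    is the restriction to the first block of the equation [(I - tau H) g = e_c]
    for the columns [g] of [G], extended by zero below the height of [V m]. *)
Lemma first_equationP {tau m} G (Y : forall k, 'M[R[i]]_(size (V k), size (V m))) :
  (forall k, (m <= k)%N -> Y k = submat G (V k) (V m)) ->
  (forall y c, (height y < m * w)%N -> G y c = 0) ->
  first_equation l u tau Y <->
  (forall x c, x \in V m -> c \in V m -> one_sub H tau (G^~ c) x = unit_vec c x).
Proof.
move=> YG G0; rewrite /first_equation !YG// mulmxBl mul1mx -scalemxAl.
rewrite /Ablk /Bblk !submat_mul (submat1 (hrange_uniq _ _)).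
rewrite (_ : _ - _ = submat (fun x c => G x c - tau%:C%C * (\sum_(y <- V m) H x y * G y c)
   - tau%:C%C * (\sum_(y <- V m.+1) H x y * G y c)) (V m) (V m)); last first.
  by apply/matrixP => i j; rewrite !mxE.
split=> [/submatP E|E].
  move=> x c xm cm; rewrite -[RHS]/((x == c)%:R) -E// /one_sub.
  rewrite (matop_first_block xm) => [|y hy].
    by rewrite mulrDr opprD addrA.
  exact: G0.
apply/submatP => x c xm cm; rewrite -[RHS]/(unit_vec c x) -E// /one_sub.
rewrite (matop_first_block xm) => [|y hy].
  by rewrite mulrDr opprD addrA.
exact: G0.
Qed.

Lemma later_equationP {tau m} k G (Y : forall k, 'M[R[i]]_(size (V k), size (V m))) :
  (m <= k)%N -> (forall k, (m <= k)%N -> Y k = submat G (V k) (V m)) ->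
  later_equation l u tau Y k <->
  (forall x c, x \in V k.+1 -> c \in V m -> one_sub H tau (G^~ c) x = 0).
Proof.
move=> mk YG; rewrite /later_equation !YG ?leqW// ?leqW// mulmxBl mul1mx -scalemxAl.
rewrite /Ablk /Bblk /Cblk !submat_mul.
rewrite (_ : _ + _ - _ =
  submat (fun x c => one_sub H tau (G^~ c) x) (V k.+1) (V m)); last first.
  apply/matrixP => i j; rewrite !mxE /one_sub (matop_later_block _ (mem_tnth i (in_tuple _))).
  by ring.
rewrite (_ : 0 = submat (fun _ _ : hidx => 0 : R[i]) (V k.+1) (V m)) ?submatP//.
by apply/matrixP => i j; rewrite !mxE.
Qed.

(** Any family of blocks is cut out of one function, so [first_equationP] and
    [later_equationP] apply to an arbitrary solution of the block equations. *)
Lemma submat_represents m (Y : forall k, 'M[R[i]]_(size (V k), size (V m))) : (0 < w)%N ->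
  exists G, (forall k, (m <= k)%N -> Y k = submat G (V k) (V m)) /\
    (forall y c, (height y < m * w)%N -> G y c = 0).
Proof.
move=> w0; pose k x := (height x %/ w)%N.
pose G x c := if (m <= k x)%N then
   match (insub (index x (V (k x))) : option 'I_(size (V (k x)))),
         (insub (index c (V m)) : option 'I_(size (V m))) with
   | Some i, Some j => Y (k x) i j
   | _, _ => 0
   end else 0.
exists G; split=> [k' mk|y c hy]; last first.
  by rewrite /G ifN// /k -ltnNge ltn_divLR.
apply/matrixP => i j; rewrite mxE.
set x := tnth _ i; set c := tnth _ j.
have kx : k x = k' by apply: V_height; exact: mem_tnth.
have ix : index x (V k') = i by rewrite /x (tnth_nth x) index_uniq ?hrange_uniq.
have ic : index c (V m) = j by rewrite /c (tnth_nth c) index_uniq ?hrange_uniq.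
by rewrite /G kx mk ix ic !valK.
Qed.

End BlockEquations.

(** * The Green functions of the height-ordered matrix *)

Section GreenFunctions.
Context {R : realType} {p q : nat}.
Variables (l : 'I_p -> nat -> R[i]) (u : 'I_q -> nat -> R[i]).
Local Notation hidx := (hidx p q).
Local Notation V := (V p q).
Local Notation w := (width p q).
Local Notation H := (hmat l u).
Variables (s : \bar R) (tau K h : R).
Hypothesis hp : (0 < p)%N.
Hypothesis hs : (1 <= s)%E.
Hypothesis H0 : forall x y : hidx, 0 <= H x y.
Hypothesis tau0 : 0 <= tau.
Hypothesis Hst : boundedly_invertible s H tau K.
Hypothesis Hpos : inverse_positive s H tau.
Hypothesis Hbd : forall f, ell s f -> (lnorm s (matop H f) <= h%:E * lnorm s f)%E.

Local Notation Hfin := (@hmat_row_finite R p q l u).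

Definition height_ge m : pred hidx := fun x => (m * w <= height x)%N.

Definition height_in m N : pred hidx := fun x => (m * w <= height x < N.+1 * w)%N.

Lemma V_height_in m N k x : (m <= k <= N)%N -> x \in V k -> height_in m N x.
Proof.
move=> /andP[mk kN]; rewrite mem_V => /andP[kx xk]; apply/andP; split.
  by apply: leq_trans kx; rewrite leq_mul2r mk orbT.
by apply: (leq_trans xk); rewrite leq_mul2r ltnS kN orbT.
Qed.

Lemma V_height_ge m k x : (m <= k)%N -> x \in V k -> height_ge m x.
Proof.
by move=> mk xk; have /andP[] : height_in m k x by apply: V_height_in xk; rewrite mk leqnn.
Qed.

Lemma height_in_widen m N N' x : (N <= N')%N -> height_in m N x -> height_in m N' x.
Proof.
move=> NN' /andP[mx xN]; rewrite /height_in mx /=; apply: (leq_trans xN).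
by rewrite leq_mul2r ltnS NN' orbT.
Qed.

Lemma width_gt0 : (0 < w)%N.
Proof.
by rewrite leq_max divn_gt0 ?gcdn_gt0 ?hp//= dvdn_leq ?dvdn_gcdl.
Qed.

(** The heights at the first position are the multiples of [Rred p q]. *)
Lemma height_ge_inhabited m : {x : hidx | height_ge m x}.
Proof.
pose x : nat * 'I_(p + q) := ((Rred p q * (m * w))%N, lshift q (Ordinal hp)).
have v : hvalid x.
  rewrite /hvalid /omega /=.
  by rewrite (unsplitK (inl _)) /= mul0n subn0 dvdn_mulr.
exists (exist (fun x => hvalid x) x v : hidx); rewrite /height_ge /height /= leq_pmull//.
by rewrite /Rred addn_gt0 divn_gt0 ?gcdn_gt0 ?hp//= dvdn_leq ?dvdn_gcdl.
Qed.

Lemma ell_unit_vec (c : hidx) : ell s (unit_vec c : hidx -> R[i]).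
Proof.
by apply: (@ell_finite_support _ _ _ hs [:: c]) => z; rewrite inE /unit_vec => /negPf ->.
Qed.

Lemma unit_vec_ge0 (c x : hidx) : 0 <= unit_vec c x :> R[i].
Proof. by rewrite /unit_vec ler0n. Qed.

Lemma inv_ge_solves m c : height_ge m c ->
  ell s (fun x => inv_ge l u s m tau x c) /\
  solves H tau (height_ge m) (unit_vec c) (fun x => inv_ge l u s m tau x c).
Proof.
move=> mc; pose c' : hidx_ge p q m := exist _ c mc.
have [eG sG] := opinv_solves (height_ge_inhabited m) hs Hfin H0 tau0 Hst Hpos Hbd c'.
suff E : (fun x => inv_ge l u s m tau x c) =
  ext0 (opinv s (id_sub_tau l u (m := m) tau) (unit_vec c')).
  by rewrite E.
apply/funext => x; rewrite /inv_ge /ext0.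
have -> : (insub c : option (hidx_ge p q m)) = Some c' by rewrite -[c]/(val c') valK.
by case: insub.
Qed.

Lemma inv_ge_ge0 m c x : height_ge m c -> 0 <= inv_ge l u s m tau x c.
Proof.
move=> /inv_ge_solves[eG sG]; move: x.
exact: (solves_ge0 hs Hfin H0 tau0 Hst Hpos (ell_unit_vec c) (unit_vec_ge0 c) eG sG).
Qed.

Lemma matop_height_in m N f x : (forall y, ~~ height_in m N y -> f y = 0) ->
  matop H f x = \sum_(y <- Vseg p q m N) H x y * f y.
Proof.
move=> f0; apply: matopE_supp; first exact: hrange_uniq.
move=> y; rewrite mulf_eq0 negb_or => /andP[_].
by apply: contraNT; rewrite mem_Vseg => /f0 ->.
Qed.

Lemma inv_seg_out m N x c : ~~ height_in m N x -> inv_seg l u m N tau x c = 0.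
Proof.
by move=> xout; rewrite /inv_seg insubN// index_mem mem_Vseg.
Qed.

(** The Green functions [G c] of the finite compression, given by [solves_exists],
    are the columns of a right inverse of the finite matrix; this proves that it is
    invertible and computes its inverse. *)
Lemma inv_seg_spec m N : (id_sub_tau_seg l u m N tau \in unitmx) /\
  forall c, height_in m N c -> ell s (fun x => inv_seg l u m N tau x c) /\
    solves H tau (height_in m N) (unit_vec c) (fun x => inv_seg l u m N tau x c).
Proof.
have /choice [G GP] : forall c, exists g,
    ell s g /\ solves H tau (height_in m N) (unit_vec c) g.
  move=> c; have [g eg sg] :=
    solves_exists hs Hfin H0 tau0 Hst Hpos (height_in m N) (ell_unit_vec c).
  by exists g.
pose S := submat (fun x c => G c x) (Vseg p q m N) (Vseg p q m N).
have MS : id_sub_tau_seg l u m N tau *m S = 1%:M.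
  rewrite /id_sub_tau_seg mulmxBl mul1mx -scalemxAl submat_mul (submat1 (hrange_uniq _ _)).
  apply/matrixP => i j; rewrite !mxE; set x := tnth _ i; set c := tnth _ j.
  have xin : height_in m N x by rewrite /height_in -mem_Vseg mem_tnth.
  have [_ [Go Gi]] := GP c.
  rewrite -[RHS]/(unit_vec c x) -(Gi x xin) /one_sub.
  by rewrite (matop_height_in (m := m) (N := N)).
have [Mu _] := mulmx1_unit MS.
split=> // c cin; have [eG sG] := GP c.
suff E : (fun x => inv_seg l u m N tau x c) = G c by rewrite E.
apply/funext => x; rewrite /inv_seg.
have -> : invmx (id_sub_tau_seg l u m N tau) = S.
  by rewrite -[LHS]mulmx1 -MS mulKmx.
have cs : (index c (Vseg p q m N) < size (Vseg p q m N))%N by rewrite index_mem mem_Vseg.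
rewrite (insubT (fun i => (i < _)%N) cs); case: insubP => [i _ iE|].
  rewrite mxE !(tnth_nth c) /= iE !nth_index ?mem_Vseg//.
  by rewrite -mem_Vseg -index_mem -iE ltn_ord.
by rewrite index_mem mem_Vseg => xout; rewrite sG.1.
Qed.

(** For [N < m] the segment is empty and both the solution and the equation are
    trivial; including this case makes the sequence in [N] start at [0]. *)
Lemma inv_seg_solves m N c : c \in V m -> ell s (fun x => inv_seg l u m N tau x c) /\
  solves H tau (height_in m N) (unit_vec c) (fun x => inv_seg l u m N tau x c).
Proof.
move=> cm; have [mN|Nm] := leqP m N.
  apply: (inv_seg_spec m N).2; apply: (height_in_widen mN).
  by apply: V_height_in cm; rewrite leqnn.
have empty x : height_in m N x = false.
  apply/negP => /andP[mx xN]; move: (leq_ltn_trans mx xN).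
  by rewrite ltn_mul2r ltnS [(m <= N)%N]leqNgt Nm andbF.
have E : (fun x => inv_seg l u m N tau x c) = fun=> 0.
  by apply/funext => x; rewrite inv_seg_out// empty.
rewrite E; split; last by split=> x; rewrite empty.
exact: (ell_finite_support hs (r := [::])).
Qed.

(** Decomposition at the last passage out of the block [V m]. Above [V m] the column
    [g] of the inverse solves the equation for the compression to the heights from
    [V m.+1] on, with right-hand side [tau H (g restricted to V m)]; by
    tridiagonality this right-hand side lives on [V m.+1], so it is a combination of
    unit vectors there, and uniqueness applies. *)
Lemma inv_ge_next_block m x c : x \in V m.+1 -> c \in V m ->
  inv_ge l u s m tau x c = \sum_(z' <- V m.+1) inv_ge l u s m.+1 tau x z' *
    (tau%:C%C * \sum_(z <- V m) H z' z * inv_ge l u s m tau z c).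
Proof.
move=> xm cm; have [eg sg] := inv_ge_solves (V_height_ge (leqnn m) cm).
set g := (fun x => inv_ge l u s m tau x c) in eg sg *.
(* g splits as g' above V m plus b on V m; a is the source that b produces. *)
pose g' y := if height_ge m.+1 y then g y else 0.
pose a z' := tau%:C%C * \sum_(z <- V m) H z' z * g z.
have eg' : ell s g'.
  by apply: ell_le eg => // y; rewrite /g'; case: ifP; rewrite ?normr0 ?normr_ge0.
have sg' : solves H tau (height_ge m.+1)
    (fun y => \sum_(z' <- V m.+1) a z' * unit_vec z' y) g'.
  split=> y my; first by rewrite /g' (negPf my).
  have my' : height_ge m y by move: my; rewrite /height_ge; nia.
  have gy : g y = tau%:C%C * matop H g y.
    have := sg.2 y my'; rewrite /one_sub /unit_vec (_ : y == c = false).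
      by move/eqP; rewrite subr_eq0 => /eqP.
    apply/negP => /eqP yc; move: cm my; rewrite -yc mem_V /height_ge; lia.
  pose b z := if height_ge m.+1 z then 0 else g z.
  have gE : matop H g y = matop H g' y + matop H b y.
    rewrite -(matopD Hfin); congr matop; apply/funext => z; rewrite /g' /b.
    by case: ifP; rewrite ?addr0 ?add0r.
  have bE : matop H b y = \sum_(z <- V m) H y z * g z.
    rewrite (@matopE_supp _ _ _ (V m)) ?hrange_uniq// => [|z].
      apply: eq_big_seq => z; rewrite mem_V /b /height_ge => zm.
      by rewrite ifN// -ltnNge; move: zm => /andP[].
    rewrite mulf_eq0 negb_or /b => /andP[_]; case: ifPn => [_|zm gz]; first by rewrite eqxx.
    rewrite mem_V; apply/andP; split; last by rewrite ltnNge.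
    by apply: contraNT gz => /(sg.1) ->.
  have -> : one_sub H tau g' y = a y.
    by rewrite /one_sub {1}/g' my gy gE bE /a; ring.
  case: (boolP (y \in V m.+1)) => ym.
    rewrite (bigD1_seq y)//= ?hrange_uniq// /unit_vec eqxx mulr1 big1 ?addr0// => z zy.
    by rewrite eq_sym (negPf zy) mulr0.
  rewrite /a big_seq big1 ?mulr0 => [|z zm].
    rewrite big_seq big1// => z zm; rewrite /unit_vec.
    case: eqP => [yz|]; last by rewrite mulr0.
    by move: ym; rewrite yz zm.
  case: (eqVneq (H y z) 0) => [->|/hmat_band[h1 h2]]; first by rewrite mul0r.
  by move: zm ym my; rewrite !mem_V /height_ge; nia.
have solv z' : z' \in V m.+1 -> ell s (fun x => inv_ge l u s m.+1 tau x z') /\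
    solves H tau (height_ge m.+1) (unit_vec z') (fun x => inv_ge l u s m.+1 tau x z').
  by move=> zm; apply: inv_ge_solves; exact: V_height_ge zm.
have [es ss] := solves_sum hs Hfin a solv.
have := congr1 (@^~ x) (solves_unique hs Hfin H0 tau0 Hpos eg' es sg' ss).
rewrite /g' (V_height_ge (leqnn _) xm) -/(g x) => ->.
by apply: eq_bigr => z' _; rewrite mulrC.
Qed.

Lemma Xblk_nonneg_solution m : nonneg_solution l u tau (Xblk l u s m tau).
Proof.
have S c : c \in V m -> solves H tau (height_ge m) (unit_vec c)
    (fun x => inv_ge l u s m tau x c).
  by move=> cm; apply: (inv_ge_solves _).2; exact: V_height_ge cm.
have out y c : (height y < m * w)%N -> inv_ge l u s m tau y c = 0.
  by move=> hy; rewrite /inv_ge insubN// -ltnNge.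
split=> [k mk i j||k mk].
- by rewrite !mxE; apply: inv_ge_ge0; apply: (@V_height_ge m m) => //; exact: mem_tnth.
- apply/(first_equationP (Y := Xblk l u s m tau) (fun _ _ => erefl) out) => x c xm cm.
  by rewrite (S c cm).2//; exact: V_height_ge xm.
apply/(later_equationP (Y := Xblk l u s m tau) mk (fun _ _ => erefl)) => x c xm cm.
rewrite (S c cm).2 /unit_vec; last by apply: V_height_ge xm; rewrite leqW.
by case: eqP => // xc; move: mk; rewrite xc in xm; rewrite (V_inj cm xm) ltnn.
Qed.

Lemma inv_seg_cvg m c x : c \in V m ->
  (fun N => inv_seg l u m N tau x c : R[i]^o) @ \oo --> (inv_ge l u s m tau x c : R[i]^o).
Proof.
move=> cm; have [eg sg] := inv_ge_solves (V_height_ge (leqnn m) cm).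
move: x; apply: (solves_cvg hs Hfin H0 tau0 Hst Hpos (Dn := height_in m) (D := height_ge m)
  (ell_unit_vec c) (unit_vec_ge0 c)) => //.
- by move=> n x; exact: height_in_widen.
- by move=> n x /andP[].
- move=> x mx; exists (height x) => // n /= hn; rewrite /height_in -/(height_ge m x) mx /=.
  by have := width_gt0; nia.
- by move=> n; have [] := inv_seg_solves n cm.
- by move=> n; have [] := inv_seg_solves n cm.
Qed.

Lemma inv_seg_mono m N N' c x : (N <= N')%N -> c \in V m ->
  inv_seg l u m N tau x c <= inv_seg l u m N' tau x c.
Proof.
move=> NN' cm; have [e1 s1] := inv_seg_solves N cm; have [e2 s2] := inv_seg_solves N' cm.
move: x; apply: (solves_mono hs Hfin H0 tau0 Hst Hpos _ (ell_unit_vec c)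
  (unit_vec_ge0 c) e1 e2 s1 s2).
by move=> x; exact: height_in_widen.
Qed.

Lemma inv_seg_ge0 m N c x : c \in V m -> 0 <= inv_seg l u m N tau x c.
Proof.
move=> cm; have [e1 s1] := inv_seg_solves N cm; move: x.
exact: (solves_ge0 hs Hfin H0 tau0 Hst Hpos (ell_unit_vec c) (unit_vec_ge0 c) e1 s1).
Qed.

(** A nonnegative solution of the block equations need not lie in [ell s], so it
    cannot be compared with the inverse directly. Its truncation to finitely many
    blocks is finitely supported and is a supersolution there, because the
    truncation drops nonnegative terms of [tau H G]. Hence it dominates the finite
    inverse, and the limit in [N] gives the claim. *)
Lemma Xblk_least m (Y : forall k, 'M[R[i]]_(size (V k), size (V m))) :
  nonneg_solution l u tau Y -> forall k, (m <= k)%N -> mxle (Xblk l u s m tau k) (Y k).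
Proof.
move=> [Y0 Y1 Y2] k mk i j; have [G [YG G0]] := submat_represents Y width_gt0.
rewrite YG// !mxE; set x := tnth _ i; set c := tnth _ j.
have cm : c \in V m by exact: mem_tnth.
have Gge0 y : 0 <= G y c.
  have [/V_block -/(_ width_gt0)[k' mk' yk']|/G0 ->//] := leqP (m * w) (height y).
  have [i' ->] : exists i', y = tnth (in_tuple (V k')) i' by exact/tnthP.
  by have := Y0 k' mk' i' j; rewrite YG// !mxE.
have Geq y : height_ge m y -> one_sub H tau (G^~ c) y = unit_vec c y.
  move=> my; have [k' mk' yk'] := V_block width_gt0 my.
  move: mk' yk'; rewrite leq_eqVlt => /predU1P[<- ym|].
    exact: (first_equationP YG G0).1.
  case: k' => // k'; rewrite ltnS => mk' yk'.
  rewrite ((later_equationP mk' YG).1 (Y2 k' mk'))// /unit_vec.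
  by case: eqP => // yc; move: mk'; rewrite yc in yk'; rewrite (V_inj cm yk') ltnn.
have segG N y : inv_seg l u m N tau y c <= G y c.
  have [e1 s1] := inv_seg_solves N cm.
  pose g y := if height_in m N y then G y c else 0.
  have gG y' : g y' <= G y' c by rewrite /g; case: ifP.
  have g0 y' : 0 <= g y' by rewrite /g; case: ifP.
  apply: le_trans (gG y).
  have eg : ell s g.
    apply: (ell_finite_support hs (r := Vseg p q m N)) => z.
    by rewrite mem_Vseg /g /height_in => /negPf ->.
  move: y; apply: (solves_le hs Hfin H0 tau0 Hpos e1 eg _ g0 s1).
    by move=> y; exact: inv_seg_ge0.
  move=> y my; rewrite -Geq; last by move: my => /andP[].
  by rewrite /one_sub /g my lerB// ler_wpM2l ?ler0c// (matop_le Hfin).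
have [l' [Xl _ l'G]] := monotone_cvg (fun N => inv_seg_ge0 N x cm)
  (fun N => inv_seg_mono x (leqnSn N) cm) (segG^~ x).
suff -> : inv_ge l u s m tau x c = l' by [].
apply: (@cvg_unique R[i]^o (@norm_hausdorff _ _)
  ((fun N => inv_seg l u m N tau x c : R[i]^o) @ \oo)); last exact: Xl.
exact: inv_seg_cvg.
Qed.

Lemma Xseg_equations m N : (m <= N)%N ->
  [/\ first_equation l u tau (Xseg l u m N tau),
    forall k, (m <= k < N)%N -> later_equation l u tau (Xseg l u m N tau) k
  & Xseg l u m N tau N.+1 = 0].
Proof.
move=> mN.
have out y c : (height y < m * w)%N -> inv_seg l u m N tau y c = 0.
  by move=> hy; rewrite inv_seg_out// /height_in leqNgt hy.
split.
- apply/(first_equationP (Y := Xseg l u m N tau) (fun _ _ => erefl) out) => x c xm cm.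
  have [_ [_ ->]] // := inv_seg_solves N cm.
  by apply: V_height_in xm; rewrite leqnn.
- move=> k /andP[mk kN].
  apply/(later_equationP (Y := Xseg l u m N tau) mk (fun _ _ => erefl)) => x c xk cm.
  have [_ [_ ->]] := inv_seg_solves N cm; last by apply: V_height_in xk; rewrite leqW.
  rewrite /unit_vec; case: eqP => // xc; move: mk; rewrite xc in xk.
  by rewrite (V_inj cm xk) ltnn.
apply/matrixP => i j; rewrite !mxE; apply: inv_seg_out.
have := mem_tnth i (in_tuple (V N.+1)); rewrite mem_V => /andP[hN _].
by rewrite /height_in ltnNge hN andbF.
Qed.

End GreenFunctions.

Theorem theorem3p41 (R : realType) (p q : nat) (hp : (0 < p)%N) (hq : (0 < q)%N)
    (l : 'I_p -> nat -> R[i]) (u : 'I_q -> nat -> R[i])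
    (s : \bar R) (hs : (1 <= s)%E) (tau : R) (m : nat)
    (Hnonneg : forall x y : hidx p q, 0 <= hmat l u x y)
    (Hbounded : bounded_operator s (matop (hmat l u)))
    (tau_ge0 : 0 <= tau)
    (tau_lt : (tau%:E < (spectral_radius s (matop (hmat l u)))^-1)%E) :
  [/\ invertible s (id_sub_tau l u (m := m) tau),
      least_nonneg_solution l u tau (Xblk l u s m tau),
      Xblk l u s m tau m = Phi l u s m tau,
      Xblk l u s m tau m.+1
        = tau%:C%C *: (Phi l u s m.+1 tau *m Cblk l u m *m Phi l u s m tau)
    & [/\ forall N, (m <= N)%N ->
            [/\ id_sub_tau_seg l u m N tau \in unitmx,
                first_equation l u tau (Xseg l u m N tau),
                forall k, (m <= k < N)%N ->
                  later_equation l u tau (Xseg l u m N tau) k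
              & Xseg l u m N tau N.+1 = 0],
          forall k N N', (m <= k)%N -> (k <= N)%N -> (N <= N')%N ->
            mxle (Xseg l u m N tau k) (Xseg l u m N' tau k)
        & forall k, (m <= k)%N -> forall i j,
            (fun N => Xseg l u m N tau k i j : R[i]^o) @ \oo
              --> (Xblk l u s m tau k i j : R[i]^o)]].
Proof.
have x0 : hidx p q := sval (@height_ge_inhabited p q hp 0).
have [h h0 Hbd] := bounded_pos x0 hs Hbounded.
have Hfin := @hmat_row_finite R p q l u.
have st t : 0 <= t -> t <= tau -> exists2 K, 0 < K & boundedly_invertible s (hmat l u) t K.
  move=> t0 ttau; apply: (boundedly_invertible_of_radius x0 hs Hbd t0).
  by apply: (le_lt_trans _ tau_lt); rewrite lee_fin.
have Hpos := inverse_positive_upto x0 hs Hfin Hnonneg h0 Hbd tau_ge0 st.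
have [K _ Hst] := st tau tau_ge0 (lexx _).
split.
- exact: (compression_invertible (height_ge_inhabited (q := q) hp m) hs Hfin
    Hnonneg tau_ge0 Hst Hpos Hbd).
- split; first exact: (Xblk_nonneg_solution hp hs Hnonneg tau_ge0 Hst Hpos Hbd m).
  exact: (Xblk_least hp hs Hnonneg tau_ge0 Hst Hpos Hbd).
- by [].
- rewrite /Xblk /Phi /Cblk -mulmxA !submat_mul.
  apply/matrixP => i j; rewrite !mxE.
  rewrite (inv_ge_next_block hp hs Hnonneg tau_ge0 Hst Hpos Hbd) ?mem_tnth//.
  by rewrite big_distrr; apply: eq_bigr => z _; rewrite mulrCA.
split.
- move=> N mN; have [E1 E2 E3] := Xseg_equations hs Hnonneg tau_ge0 Hst Hpos mN.
  by split=> //; have [] := inv_seg_spec hs Hnonneg tau_ge0 Hst Hpos m N.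
- move=> k N N' mk kN NN' i j; rewrite !mxE.
  by apply: (inv_seg_mono hs Hnonneg tau_ge0 Hst Hpos) => //; exact: mem_tnth.
move=> k mk i j; rewrite mxE.
rewrite (_ : (fun N => _) = fun N => inv_seg l u m N tau
   (tnth (in_tuple (V p q k)) i) (tnth (in_tuple (V p q m)) j)); last first.
  by apply/funext => N; rewrite mxE.
by apply: (inv_seg_cvg hp hs Hnonneg tau_ge0 Hst Hpos Hbd); exact: mem_tnth.
Qed.
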